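(* Let $\gamma>1$ and $c_0>0$ be constants, and let $n:[0,1]\to(0,\infty)$ be a smooth function with $n''(t)>0$ for $t\in[0,1]$, $n'(t)<0$ for $t\in(0,1)$, $n'(1)=0$ and $n(1)=1$. Let $\mathcal{M}=(0,1)\times\mathbf{S}^1$, $\bar{\mathcal{M}}=[0,1]\times\mathbf{S}^1$, $\Sigma_0=\{0\}\times\mathbf{S}^1$, $\Sigma_1=\{1\}\times\mathbf{S}^1$. Let $b_0,b_1$ and the symmetric solution $\varphi_b$ be as defined in the context. For a function $\varphi$ on $\bar{\mathcal{M}}$ consider the equation $$n(x)^2\bigl(c^2-(\partial_1\varphi)^2\bigr)\partial_{11}\varphi-2\,\partial_1\varphi\,\partial_2\varphi\,\partial_{12}\varphi+\Bigl(c^2-\frac{(\partial_2\varphi)^2}{n(x)^2}\Bigr)\partial_{22}\varphi+n(x)n'(x)\Bigl(c^2+\frac{(\partial_2\varphi)^2}{n(x)^2}\Bigr)\partial_1\varphi=0\quad\text{in }\mathcal{M},\qquad (\mathrm{E})$$ where $c^2$ is given by $$\frac{c^2}{\gamma-1}+\frac{(\partial_1\varphi)^2+(\partial_2\varphi)^2/n(x)^2}{2}=\frac{c_0}{\gamma-1},$$ the exit condition $$(\partial_1\varphi)^2+(\partial_2\varphi)^2=b_1^2\quad\text{on }\Sigma_1,\qquad (\mathrm{X})$$ and the sign conditions $$\partial_1\varphi\ge 0\ \text{ on }\Sigma_0\cup\Sigma_1,\qquad \partial_{11}\varphi>0\ \text{ on }\Sigma_1.\qquad (\mathrm{S})$$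 (i) The only solution $\varphi\in C^2(\bar{\mathcal{M}})$ of (E), (X) and the entry condition $$(\partial_1\varphi)^2+\frac{(\partial_2\varphi)^2}{n(0)^2}=b_0^2\quad\text{on }\Sigma_0$$ that satisfies (S) is, up to an additive constant, the symmetric solution $\varphi_b$. (ii) Let $B=B(y)$ be a positive function on $\mathbf{S}^1$ that is not identically equal to $b_0^2$ and satisfies either $B(y)\ge b_0^2$ for all $y$ or $B(y)\le b_0^2$ for all $y$. Then there is no $\varphi\in C^2(\bar{\mathcal{M}})$ satisfying (E), (X), (S) and the entry condition $$(\partial_1\varphi)^2+\frac{(\partial_2\varphi)^2}{n(0)^2}=B(y)\quad\text{on }\Sigma_0.$$
   Context: Coordinates on $\mathcal{M}$ are $(x,y)$ with $x\in(0,1)$ and $y\in\mathbf{S}^1$ (the standard unit circle), $y$ being regarded as an angle in $(0,2\pi)$ with $2\pi$-periodicity; $\partial_1=\partial_x$, $\partial_2=\partial_y$, $\partial_{ij}=\partial_i\partial_j$. ($\mathcal{M}$ carries the Riemannian metric $dx\otimes dx+n(x)^2\,dy\otimes dy$, and (E) is the steady potential flow equation on it, $c$ being the speed of sound.) $C^2(\bar{\mathcal{M}})$ denotes functions on $[0,1]\times\mathbf{S}^1$ that are $C^2$ up to the boundary. Constants: $b_1>0$ is defined by $b_1^2=\frac{2c_0}{\gamma+1}$, and $b_0$ is the unique number with $0<b_0<b_1$ and $$b_0^{\gamma-1}\Bigl(c_0-\frac{\gamma-1}{2}b_0^2\Bigr)n(0)^{\gamma-1}=b_1^{\gamma+1}.$$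 Symmetric solution: let $u=u(x)$ and $\rho=\rho(x)>0$ on $[0,1]$ be the solution of $$\frac{d}{dx}(n\rho u)=0,\qquad \frac{\gamma\rho^{\gamma-1}}{\gamma-1}+\frac{u^2}{2}=\frac{c_0}{\gamma-1},\qquad u(0)=b_0,\quad u(1)=b_1,$$ for which the flow is subsonic on $[0,1)$ (i.e. $0<u^2<\gamma\rho^{\gamma-1}$ there), sonic at $x=1$ (i.e. $u^2=\gamma\rho^{\gamma-1}$ there), and accelerating ($u'(x)>0$ for $x\in(0,1)$). Then $\varphi_b=\varphi_b(x)$ denotes a function depending only on $x$ with $\varphi_b'(x)=u(x)$; it is determined up to an additive constant. *)

(* Defs.v *)
From Stdlib Require Import Reals Lra.
From Coquelicot Require Import Coquelicot.

Open Scope R_scope.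

Definition I01 (x : R) : Prop := 0 <= x <= 1.

(** Calculus on the closed interval [0,1]: derivatives are relative to [0,1],
    hence one-sided at the end points, and only the values of the function on
    [0,1] matter. *)

Definition is_derive01 (f : R -> R) (x l : R) : Prop :=
  filterdiff (K := R_AbsRing) (U := R_NormedModule) (V := R_NormedModule)
    f (within I01 (locally x)) (fun h : R => scal h l).

Definition ex_derive01 (f : R -> R) (x : R) : Prop :=
  exists l : R, is_derive01 f x l.

(* A junk value when [f] has no such derivative, like [Derive]. *)
Definition Derive01 (f : R -> R) (x : R) : R :=
  @iota R_CompleteNormedModule (is_derive01 f x).

Definition continuous01 (f : R -> R) (x : R) : Prop :=
  filterlim f (within I01 (locally x)) (locally (f x)).

Definition smooth01 (f : R -> R) : Prop :=
  forall (k : nat) (x : R), I01 x -> ex_derive01 (Nat.iter k Derive01 f) x.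

Lemma is_derive01_unique (f : R -> R) (x l : R) :
  I01 x -> is_derive01 f x l -> Derive01 f x = l.
Proof.
intros Hx Hl.
apply (iota_unique (V := R_CompleteNormedModule)); [|exact Hl].
assert (Hlim : forall P : R -> Prop, locally x P -> within I01 (locally x) P).
{ intros P HP; unfold within; generalize HP; apply filter_imp; auto. }
intros m Hm.
destruct (Req_dec m l) as [E|E]; [exact E|exfalso].
assert (He : 0 < Rabs (m - l) / 4).
{ assert (0 < Rabs (m - l)) by (apply Rabs_pos_lt; lra). lra. }
pose proof (proj2 Hm x Hlim (mkposreal _ He)) as H1.
pose proof (proj2 Hl x Hlim (mkposreal _ He)) as H2.
unfold within in H1, H2.
destruct (filter_and _ _ H1 H2) as [d Hd].
pose proof (cond_pos d) as Hd0.
assert (Hy : exists y, I01 y /\ y <> x /\ Rabs (y - x) < d).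
{ unfold I01 in *; destruct (Rle_dec x (1/2)).
  - exists (x + Rmin (d/2) (1/2)).
    assert (0 < Rmin (d/2) (1/2)) by (apply Rmin_glb_lt; lra).
    pose proof (Rmin_l (d/2) (1/2)); pose proof (Rmin_r (d/2) (1/2)).
    repeat split; try lra. rewrite Rabs_pos_eq; lra.
  - exists (x - Rmin (d/2) (1/2)).
    assert (0 < Rmin (d/2) (1/2)) by (apply Rmin_glb_lt; lra).
    pose proof (Rmin_l (d/2) (1/2)); pose proof (Rmin_r (d/2) (1/2)).
    repeat split; try lra. rewrite Rabs_left; lra. }
destruct Hy as (y & Iy & Nyx & By).
destruct (Hd y By) as [K1 K2].
specialize (K1 Iy); specialize (K2 Iy).
unfold norm, minus, plus, opp, scal in K1, K2; simpl in K1, K2.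
unfold abs, mult in K1, K2; simpl in K1, K2.
assert (0 < Rabs (y - x)) by (apply Rabs_pos_lt; lra).
assert (T : Rabs ((m - l) * (y - x)) <= 2 * (Rabs (m - l) / 4 * Rabs (y - x))).
{ replace ((m - l) * (y - x)) with
    ((f y + - f x + - ((y + - x) * l)) - (f y + - f x + - ((y + - x) * m))) by ring.
  eapply Rle_trans; [apply Rabs_triang|]. rewrite Rabs_Ropp.
  unfold Rminus in *; lra. }
rewrite Rabs_mult in T. nra.
Qed.

(** A function on [0,1] x S^1 is a map [phi : R -> R -> R] that is
    2 pi-periodic in its second argument; its values for [x] outside [0,1] are
    irrelevant. *)

Definition periodic (f : R -> R) : Prop := forall y, f (y + 2 * PI) = f y.

Definition D1 (phi : R -> R -> R) (x y : R) : R := Derive01 (fun t => phi t y) x.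
Definition D2 (phi : R -> R -> R) (x y : R) : R := Derive (fun t => phi x t) y.

Definition C0bar (phi : R -> R -> R) : Prop :=
  forall x y, I01 x ->
    filterlim (fun z : R * R => phi (fst z) (snd z))
      (within (fun z : R * R => I01 (fst z)) (locally (x, y)))
      (locally (phi x y)).

Fixpoint Ckbar (k : nat) (phi : R -> R -> R) : Prop :=
  match k with
  | O => C0bar phi
  | S k' =>
      C0bar phi /\
      (forall x y, I01 x ->
         ex_derive01 (fun t => phi t y) x /\ ex_derive (fun t => phi x t) y) /\
      Ckbar k' (D1 phi) /\ Ckbar k' (D2 phi)
  end.

Definition C2_cylinder (phi : R -> R -> R) : Prop :=
  (forall x, I01 x -> periodic (phi x)) /\ Ckbar 2 phi.

Definition admissible_profile (n : R -> R) : Prop :=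
  (forall x, I01 x -> 0 < n x) /\
  smooth01 n /\
  (forall x, I01 x -> 0 < Derive01 (Derive01 n) x) /\
  (forall x, 0 < x < 1 -> Derive01 n x < 0) /\
  Derive01 n 1 = 0 /\
  n 1 = 1.

Definition is_b1 (gamma c0 b1 : R) : Prop :=
  0 < b1 /\ b1 ^ 2 = 2 * c0 / (gamma + 1).

Definition is_b0 (gamma c0 : R) (n : R -> R) (b1 b0 : R) : Prop :=
  0 < b0 < b1 /\
  Rpower b0 (gamma - 1) * (c0 - (gamma - 1) / 2 * b0 ^ 2)
    * Rpower (n 0) (gamma - 1) = Rpower b1 (gamma + 1).

(* [gamma * rho^(gamma-1)] is the square of the speed of sound. *)
Definition symmetric_flow (gamma c0 : R) (n : R -> R) (b0 b1 : R)
    (u rho : R -> R) : Prop :=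
  (forall x, I01 x -> continuous01 u x /\ continuous01 rho x) /\
  (forall x, 0 < x < 1 -> ex_derive u x /\ ex_derive rho x) /\
  (forall x, I01 x -> 0 < rho x) /\
  (forall x, 0 < x < 1 -> is_derive (fun t => n t * rho t * u t) x 0) /\
  (forall x, I01 x ->
     gamma * Rpower (rho x) (gamma - 1) / (gamma - 1) + (u x) ^ 2 / 2
       = c0 / (gamma - 1)) /\
  u 0 = b0 /\ u 1 = b1 /\
  (forall x, 0 <= x < 1 -> 0 < (u x) ^ 2 < gamma * Rpower (rho x) (gamma - 1)) /\
  (u 1) ^ 2 = gamma * Rpower (rho 1) (gamma - 1) /\
  (forall x, 0 < x < 1 -> 0 < Derive u x).

Definition symmetric_solution (gamma c0 : R) (n : R -> R) (b0 b1 : R)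
    (phib : R -> R) : Prop :=
  exists u rho : R -> R,
    symmetric_flow gamma c0 n b0 b1 u rho /\
    (forall x, I01 x -> is_derive01 phib x (u x)).

(* [|grad phi|^2] for the metric dx^2 + n(x)^2 dy^2. *)
Definition speed2 (n : R -> R) (phi : R -> R -> R) (x y : R) : R :=
  (D1 phi x y) ^ 2 + (D2 phi x y) ^ 2 / (n x) ^ 2.

(* Bernoulli's law c^2/(gamma-1) + speed2/2 = c0/(gamma-1), solved for c^2. *)
Definition sound2 (gamma c0 : R) (n : R -> R) (phi : R -> R -> R) (x y : R) : R :=
  (gamma - 1) * (c0 / (gamma - 1) - speed2 n phi x y / 2).

Definition potential_equation (gamma c0 : R) (n : R -> R) (phi : R -> R -> R) : Prop :=
  forall x y, 0 < x < 1 ->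
    let c2 := sound2 gamma c0 n phi x y in
    let p1 := D1 phi x y in
    let p2 := D2 phi x y in
    (n x) ^ 2 * (c2 - p1 ^ 2) * D1 (D1 phi) x y
    - 2 * p1 * p2 * D1 (D2 phi) x y
    + (c2 - p2 ^ 2 / (n x) ^ 2) * D2 (D2 phi) x y
    + n x * Derive01 n x * (c2 + p2 ^ 2 / (n x) ^ 2) * p1 = 0.

Definition exit_condition (b1 : R) (phi : R -> R -> R) : Prop :=
  forall y, (D1 phi 1 y) ^ 2 + (D2 phi 1 y) ^ 2 = b1 ^ 2.

Definition entry_condition (n : R -> R) (B : R -> R) (phi : R -> R -> R) : Prop :=
  forall y, (D1 phi 0 y) ^ 2 + (D2 phi 0 y) ^ 2 / (n 0) ^ 2 = B y.

Definition sign_conditions (phi : R -> R -> R) : Prop :=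
  (forall y, 0 <= D1 phi 0 y /\ 0 <= D1 phi 1 y) /\
  (forall y, 0 < D1 (D1 phi) 1 y).

Definition C2_solution (gamma c0 : R) (n : R -> R) (b1 : R) (B : R -> R)
    (phi : R -> R -> R) : Prop :=
  C2_cylinder phi /\
  potential_equation gamma c0 n phi /\
  exit_condition b1 phi /\
  entry_condition n B phi /\
  sign_conditions phi.

(* Main.v *)
Require Import Defs.
From Stdlib Require Import Reals Lra ZArith Ranalysis5 Classical IndefiniteDescription.
From Coquelicot Require Import Coquelicot.
Open Scope R_scope.

(** The difference of a solution [phi] and of the symmetric solution [w]
    satisfies a linear equation without mixed derivative whose principal
    coefficients [n^2 (c^2 - u^2)] and [c^2] are those of the symmetric flow. It
    is therefore elliptic for [x < 1], whatever the type of the flow of [phi],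
    and degenerates only at the sonic circle [x = 1]
    ([difference_degenerate_elliptic]).

    At the exit, the equation and the tangential derivative of the exit condition
    force the flow of [phi] to be radial and sonic ([exit_flow_radial]), so
    [phi - w] is constant there with vanishing normal derivative. The condition
    [phi11 > 0] gives the first order coefficient of the degenerate equation the
    sign that makes the Hopf lemma valid up to the sonic circle ([hopf]);
    so an extremum of a nonconstant difference cannot lie at the exit, and it lies
    on the entry circle, where the normal derivative is then strictly signed
    ([max_principle_constant]). But at such a point the tangential derivative of
    [phi] vanishes, and the entry condition together with [phi1 >= 0] says that
    [phi1] is the square root of [B]. If [B >= b0^2] this contradicts the sign at
    a maximum, if [B <= b0^2] the sign at a minimum. Either way [phi - w] is
    constant ([rigidity]), and then [B = b0^2]. Both parts of the theorem follow.

    The symmetric flow itself exists because the logarithm of the mass flux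
    density increases with the speed below the speed of sound, which makes the
    conservation laws invertible ([symmetric_flow_exists]). That it is twice
    differentiable up to the sonic circle, as a solution must be, is not
    immediate, since its differential equation is singular there
    ([symmetric_speed_exists]). *)

(** * Calculus relative to the closed unit interval *)

Lemma is_derive01_eps (f : R -> R) (x l : R) :
  I01 x ->
  (is_derive01 f x l <->
   forall eps, 0 < eps -> exists d, 0 < d /\
     forall y, I01 y -> Rabs (y - x) < d ->
       Rabs (f y - f x - (y - x) * l) <= eps * Rabs (y - x)).
Proof.
intros Hx; split.
- intros [_ H] eps He.
  assert (Hlim : is_filter_lim (within I01 (locally x)) x).
  { intros P HP; unfold within; generalize HP; apply filter_imp; auto. }
  destruct (H x Hlim (mkposreal eps He)) as [d Hd].
  exists d; split; [apply cond_pos|]. intros y Hy Hyd.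
  exact (Hd y Hyd Hy).
- intros H; split.
  + exact (is_linear_scal_l (K := R_AbsRing) (V := R_NormedModule) l).
  + intros x' Hx' eps.
    destruct (Req_dec x' x) as [->|E].
    * destruct (H eps (cond_pos eps)) as (d & Hd & Hy).
      exists (mkposreal d Hd); intros y Hyd Iy. exact (Hy y Iy Hyd).
    * (* the only limit of the filter is [x], because [x] lies in [0,1] *)
      exfalso.
      assert (Hp : 0 < Rabs (x' - x) / 2).
      { assert (0 < Rabs (x' - x)) by (apply Rabs_pos_lt; lra). lra. }
      assert (HP : locally x' (fun z => Rabs (z - x') < Rabs (x' - x) / 2)).
      { exists (mkposreal _ Hp); intros z Hz; exact Hz. }
      destruct (Hx' _ HP) as [d Hd].
      specialize (Hd x (ball_center x d) Hx).
      rewrite Rabs_minus_sym in Hd; lra.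
Qed.

Lemma continuous01_eps (f : R -> R) (x : R) :
  continuous01 f x <->
  forall eps, 0 < eps -> exists d, 0 < d /\
    forall y, I01 y -> Rabs (y - x) < d -> Rabs (f y - f x) < eps.
Proof.
unfold continuous01. rewrite filterlim_locally. split.
- intros H eps He. destruct (H (mkposreal eps He)) as [d Hd].
  exists d; split; [apply cond_pos|]. intros y Iy Hy. exact (Hd y Hy Iy).
- intros H eps. destruct (H eps (cond_pos eps)) as (d & Hd & Hy).
  exists (mkposreal d Hd); intros y Hyd Iy; exact (Hy y Iy Hyd).
Qed.

Lemma is_derive_is_derive01 (f : R -> R) (x l : R) :
  I01 x -> is_derive f x l -> is_derive01 f x l.
Proof.
intros Hx [_ H]. apply is_derive01_eps; [exact Hx|]. intros eps He.
assert (Hlim : is_filter_lim (locally x) x) by (intros P HP; exact HP).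
destruct (H x Hlim (mkposreal eps He)) as [d Hd].
exists d; split; [apply cond_pos|]. intros y _ Hy. exact (Hd y Hy).
Qed.

Lemma locally_interior (x : R) : 0 < x < 1 -> locally x (fun t => 0 < t < 1).
Proof.
intros Hx. assert (Hp : 0 < Rmin x (1 - x)) by (apply Rmin_glb_lt; lra).
exists (mkposreal _ Hp). intros t Ht.
assert (B : Rabs (t - x) < Rmin x (1 - x)) by exact Ht.
pose proof (Rmin_l x (1 - x)). pose proof (Rmin_r x (1 - x)).
apply Rabs_lt_between in B. lra.
Qed.

Lemma is_derive01_is_derive (f : R -> R) (x l : R) :
  0 < x < 1 -> is_derive01 f x l -> is_derive f x l.
Proof.
intros Hx H. assert (Ix : I01 x) by (unfold I01; lra).
pose proof (proj1 (is_derive01_eps f x l Ix) H) as H0.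
split; [exact (is_linear_scal_l (K := R_AbsRing) (V := R_NormedModule) l)|].
intros x' Hx' eps.
rewrite <- (is_filter_lim_locally_unique x x' Hx').
destruct (H0 eps (cond_pos eps)) as (d & Hd & Hy).
assert (Hp : 0 < Rmin d (Rmin x (1 - x))).
{ repeat apply Rmin_glb_lt; lra. }
exists (mkposreal _ Hp); intros y Hyd.
assert (B : Rabs (y - x) < Rmin d (Rmin x (1 - x))) by exact Hyd.
pose proof (Rmin_l d (Rmin x (1 - x))). pose proof (Rmin_r d (Rmin x (1 - x))).
pose proof (Rmin_l x (1 - x)). pose proof (Rmin_r x (1 - x)).
apply Hy; [|lra]. apply Rabs_lt_between in B. unfold I01; lra.
Qed.

Lemma is_derive01_ext (f g : R -> R) (x l : R) :
  I01 x -> (forall t, I01 t -> f t = g t) -> is_derive01 f x l -> is_derive01 g x l.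
Proof.
intros Hx E H. apply is_derive01_eps; [exact Hx|]. intros eps He.
destruct (proj1 (is_derive01_eps f x l Hx) H eps He) as (d & Hd & Hy).
exists d; split; [exact Hd|]. intros y Iy Hyd.
rewrite <- !E; auto.
Qed.

Lemma is_derive01_minus (f g : R -> R) (x l m : R) :
  I01 x -> is_derive01 f x l -> is_derive01 g x m ->
  is_derive01 (fun t => f t - g t) x (l - m).
Proof.
intros Hx Hf Hg. apply is_derive01_eps; [exact Hx|]. intros eps He.
destruct (proj1 (is_derive01_eps f x l Hx) Hf (eps / 2) ltac:(lra)) as (d & Hd & Hy).
destruct (proj1 (is_derive01_eps g x m Hx) Hg (eps / 2) ltac:(lra)) as (d' & Hd' & Hy').
exists (Rmin d d'); split; [apply Rmin_glb_lt; lra|]. intros y Iy Hyd.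
pose proof (Rmin_l d d'). pose proof (Rmin_r d d').
specialize (Hy y Iy ltac:(lra)). specialize (Hy' y Iy ltac:(lra)).
replace (f y - g y - (f x - g x) - (y - x) * (l - m))
  with ((f y - f x - (y - x) * l) - (g y - g x - (y - x) * m)) by ring.
eapply Rle_trans; [apply Rabs_triang|]. rewrite Rabs_Ropp. lra.
Qed.

Lemma is_derive01_const (c x : R) : I01 x -> is_derive01 (fun _ => c) x 0.
Proof.
intros Hx. apply is_derive_is_derive01; [exact Hx|]. apply @is_derive_const.
Qed.

Lemma is_derive01_continuous01 (f : R -> R) (x l : R) :
  I01 x -> is_derive01 f x l -> continuous01 f x.
Proof.
intros Hx H. apply continuous01_eps. intros eps He.
destruct (proj1 (is_derive01_eps f x l Hx) H 1 ltac:(lra)) as (d & Hd & Hy).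
pose proof (Rabs_pos l) as Hl.
assert (Hq : 0 < eps / (2 + Rabs l)) by (apply Rdiv_lt_0_compat; lra).
exists (Rmin d (eps / (2 + Rabs l))); split; [apply Rmin_glb_lt; lra|].
intros y Iy B.
pose proof (Rmin_l d (eps / (2 + Rabs l))). pose proof (Rmin_r d (eps / (2 + Rabs l))).
specialize (Hy y Iy ltac:(lra)).
assert (B' : (2 + Rabs l) * Rabs (y - x) < eps).
{ apply Rlt_le_trans with ((2 + Rabs l) * (eps / (2 + Rabs l))).
  - apply Rmult_lt_compat_l; lra.
  - right; field; lra. }
replace (f y - f x) with ((f y - f x - (y - x) * l) + (y - x) * l) by ring.
eapply Rle_lt_trans; [apply Rabs_triang|]. rewrite Rabs_mult.
pose proof (Rabs_pos (y - x)). nra.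
Qed.

(** At an end point of [0,1] only one of the two one-sided comparisons below is
    available; this is the form in which the Hopf lemma is used. *)
Lemma is_derive01_le_right (f g : R -> R) (x l m h : R) :
  0 <= x -> 0 < h -> x + h <= 1 ->
  is_derive01 f x l -> is_derive01 g x m -> f x = g x ->
  (forall t, x < t < x + h -> f t <= g t) -> l <= m.
Proof.
intros Hx Hh Hxh Hf Hg E Hle.
assert (Ix : I01 x) by (unfold I01; lra).
destruct (Rle_dec l m) as [|N]; [assumption|exfalso].
pose proof (is_derive01_minus f g x l m Ix Hf Hg) as H.
destruct (proj1 (is_derive01_eps _ _ _ Ix) H ((l - m) / 2) ltac:(lra)) as (d & Hd & Hy).
set (t := Rmin d h / 2).
assert (0 < t /\ t < d /\ t < h).
{ unfold t. pose proof (Rmin_l d h). pose proof (Rmin_r d h).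
  assert (0 < Rmin d h) by (apply Rmin_glb_lt; lra). lra. }
specialize (Hy (x + t)). replace (x + t - x) with t in Hy by ring.
rewrite (Rabs_pos_eq t) in Hy by lra.
specialize (Hy ltac:(unfold I01; lra) ltac:(lra)).
apply Rabs_le_between in Hy. specialize (Hle (x + t) ltac:(lra)). nra.
Qed.

Lemma is_derive01_le_left (f g : R -> R) (x l m h : R) :
  x <= 1 -> 0 < h -> 0 <= x - h ->
  is_derive01 f x l -> is_derive01 g x m -> f x = g x ->
  (forall t, x - h < t < x -> f t <= g t) -> m <= l.
Proof.
intros Hx Hh Hxh Hf Hg E Hle.
assert (Ix : I01 x) by (unfold I01; lra).
destruct (Rle_dec m l) as [|N]; [assumption|exfalso].
pose proof (is_derive01_minus f g x l m Ix Hf Hg) as H.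
destruct (proj1 (is_derive01_eps _ _ _ Ix) H ((m - l) / 2) ltac:(lra)) as (d & Hd & Hy).
set (t := Rmin d h / 2).
assert (0 < t /\ t < d /\ t < h).
{ unfold t. pose proof (Rmin_l d h). pose proof (Rmin_r d h).
  assert (0 < Rmin d h) by (apply Rmin_glb_lt; lra). lra. }
specialize (Hy (x - t)). replace (x - t - x) with (- t) in Hy by ring.
rewrite Rabs_Ropp, (Rabs_pos_eq t) in Hy by lra.
specialize (Hy ltac:(unfold I01; lra) ltac:(lra)).
apply Rabs_le_between in Hy. specialize (Hle (x - t) ltac:(lra)). nra.
Qed.

(** The retraction of the line onto [0,1]: composing with it turns continuity
    relative to [0,1] into continuity on the whole line or plane, where the
    usual theorems apply. *)
Definition clamp (x : R) : R := Rmax 0 (Rmin 1 x).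

Lemma clamp_I01 (x : R) : I01 (clamp x).
Proof.
unfold clamp, I01. split; [apply Rmax_l|]. apply Rmax_lub; [lra|apply Rmin_l].
Qed.

Lemma clamp_id (x : R) : I01 x -> clamp x = x.
Proof.
intros [H0 H1]. unfold clamp. rewrite Rmin_right by lra. apply Rmax_right; lra.
Qed.

Lemma clamp_lipschitz (x y : R) : Rabs (clamp x - clamp y) <= Rabs (x - y).
Proof.
unfold clamp, Rmax, Rmin.
repeat destruct Rle_dec; unfold Rabs; repeat destruct Rcase_abs; lra.
Qed.

Lemma continuity_pt_eps (f : R -> R) (x : R) :
  continuity_pt f x <->
  forall eps, 0 < eps -> exists d, 0 < d /\
    forall y, Rabs (y - x) < d -> Rabs (f y - f x) < eps.
Proof.
rewrite continuity_pt_locally. split.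
- intros H eps He. destruct (H (mkposreal eps He)) as [d Hd].
  exists d; split; [apply cond_pos|exact Hd].
- intros H eps. destruct (H eps (cond_pos eps)) as (d & Hd & Hy).
  exists (mkposreal d Hd); exact Hy.
Qed.

Lemma continuous01_clamp (f : R -> R) :
  (forall x, I01 x -> continuous01 f x) ->
  forall x, continuity_pt (fun t => f (clamp t)) x.
Proof.
intros H x. apply continuity_pt_eps. intros eps He.
destruct (proj1 (continuous01_eps f (clamp x)) (H _ (clamp_I01 x)) eps He) as (d & Hd & Hy).
exists d; split; [exact Hd|]. intros y B. apply Hy; [apply clamp_I01|].
eapply Rle_lt_trans; [apply clamp_lipschitz|exact B].
Qed.

Lemma C0bar_clamp (f : R -> R -> R) :
  C0bar f -> forall x y, continuity_2d_pt (fun s t => f (clamp s) t) x y.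
Proof.
intros H x y eps.
pose proof (H (clamp x) y (clamp_I01 x)) as L.
rewrite filterlim_locally in L. destruct (L eps) as [d Hd].
exists d. intros u v Hu Hv.
refine (Hd (clamp u, v) _ (clamp_I01 u)). split.
- simpl. eapply Rle_lt_trans; [apply clamp_lipschitz|exact Hu].
- exact Hv.
Qed.

Lemma C0bar_of_continuous01 (f : R -> R -> R) (g : R -> R) :
  (forall x, I01 x -> continuous01 g x) ->
  (forall x y, I01 x -> f x y = g x) -> C0bar f.
Proof.
intros Hg E x y Hx. rewrite filterlim_locally. intros eps.
destruct (proj1 (continuous01_eps g x) (Hg x Hx) eps (cond_pos eps)) as (d & Hd & Hy).
exists (mkposreal d Hd). intros [u v] [Hu _] Iu. simpl in *.
rewrite !E by auto. exact (Hy u Iu Hu).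
Qed.

(** By the mean value theorem a difference quotient at an end point is a nearby
    value of [g]. This is how the speed is differentiated at the sonic circle. *)
Lemma is_derive01_of_interior (f g : R -> R) :
  (forall x, I01 x -> continuous01 f x) ->
  (forall x, I01 x -> continuous01 g x) ->
  (forall x, 0 < x < 1 -> is_derive f x (g x)) ->
  forall x, I01 x -> is_derive01 f x (g x).
Proof.
intros Hf Hg Hd x Hx. apply is_derive01_eps; [exact Hx|]. intros eps He.
destruct (proj1 (continuous01_eps g x) (Hg x Hx) eps He) as (d & Hd0 & Hy).
exists d; split; [exact Hd0|]. intros y Iy B.
unfold I01 in Hx, Iy.
assert (Hm : 0 <= Rmin x y) by (apply Rmin_glb; lra).
assert (HM : Rmax x y <= 1) by (apply Rmax_lub; lra).
destruct (MVT_gen (fun t => f (clamp t)) x y g) as (c & Hc & E).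
- intros t Ht. assert (It : 0 < t < 1) by lra.
  apply is_derive_ext_loc with f; [|apply Hd; exact It].
  generalize (locally_interior t It). apply filter_imp.
  intros s Hs. rewrite clamp_id; [reflexivity|unfold I01; lra].
- intros t _. apply continuous01_clamp; exact Hf.
- rewrite !clamp_id in E by (unfold I01; lra).
  replace (f y - f x - (y - x) * g x) with ((g c - g x) * (y - x)) by (rewrite E; ring).
  rewrite Rabs_mult. apply Rmult_le_compat_r; [apply Rabs_pos|].
  left. apply Hy; [unfold I01; lra|].
  eapply Rle_lt_trans; [|exact B].
  revert Hc. unfold Rmin, Rmax. destruct Rle_dec; intros Hc;
  unfold Rabs; repeat destruct Rcase_abs; lra.
Qed.

Lemma continuity_2d_pt_fst (f : R -> R) (x y : R) :
  continuity_pt f x -> continuity_2d_pt (fun s _ => f s) x y.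
Proof.
intros H. apply (continuity_1d_2d_pt_comp f (fun s _ => s)); [exact H|].
apply continuity_2d_pt_id1.
Qed.

Lemma continuity_2d_pt_fix_snd (f : R -> R -> R) (x y : R) :
  continuity_2d_pt f x y -> continuity_pt (fun s => f s y) x.
Proof.
intros H. apply continuity_pt_eps. intros eps He.
destruct (H (mkposreal eps He)) as [d Hd].
exists d; split; [apply cond_pos|]. intros s Hs. apply Hd; [exact Hs|].
rewrite Rminus_eq_0, Rabs_R0; apply cond_pos.
Qed.

Lemma continuity_2d_pt_fix_fst (f : R -> R -> R) (x y : R) :
  continuity_2d_pt f x y -> continuity_pt (f x) y.
Proof.
intros H. apply continuity_pt_eps. intros eps He.
destruct (H (mkposreal eps He)) as [d Hd].
exists d; split; [apply cond_pos|]. intros s Hs. apply Hd; [|exact Hs].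
rewrite Rminus_eq_0, Rabs_R0; apply cond_pos.
Qed.

Lemma continuity_zero_closed (f : R -> R) :
  (forall x, continuity_pt f x) -> (forall x, 0 < x < 1 -> f x = 0) ->
  forall x, I01 x -> f x = 0.
Proof.
intros Hc Hz x Hx. destruct (Req_dec (f x) 0) as [|N]; [assumption|exfalso].
assert (He : 0 < Rabs (f x)) by (apply Rabs_pos_lt; exact N).
destruct (proj1 (continuity_pt_eps f x) (Hc x) _ He) as (d & Hd & Hy).
(* moving slightly towards the midpoint enters the open interval *)
set (t := Rmin d 1 / 2).
assert (0 < t /\ t < d /\ t < 1).
{ unfold t. pose proof (Rmin_l d 1). pose proof (Rmin_r d 1).
  assert (0 < Rmin d 1) by (apply Rmin_glb_lt; lra). lra. }
unfold I01 in Hx. specialize (Hy (x + t * (1 / 2 - x))).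
rewrite Hz in Hy by nra.
replace (x + t * (1 / 2 - x) - x) with (t * (1 / 2 - x)) in Hy by ring.
rewrite Rabs_mult, (Rabs_pos_eq t) in Hy by lra.
assert (Rabs (1 / 2 - x) <= 1) by (apply Rabs_le_between; lra).
pose proof (Rabs_pos (1 / 2 - x)).
specialize (Hy ltac:(nra)). rewrite Rminus_0_l, Rabs_Ropp in Hy. lra.
Qed.

Lemma is_derive_continuity_pt (f : R -> R) (x l : R) :
  is_derive f x l -> continuity_pt f x.
Proof.
intros H. apply derivable_continuous_pt. exists l. apply is_derive_Reals, H.
Qed.

Lemma continuous01_comp (h f : R -> R) (x : R) :
  continuous01 f x -> continuity_pt h (f x) -> continuous01 (fun t => h (f t)) x.
Proof.
intros Hf Hh. apply continuous01_eps. intros eps He.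
destruct (proj1 (continuity_pt_eps h (f x)) Hh eps He) as (d & Hd & H).
destruct (proj1 (continuous01_eps f x) Hf d Hd) as (d' & Hd' & H').
exists d'; split; [exact Hd'|]. intros y Iy B. apply H, H'; assumption.
Qed.

(** * Compactness and the second derivative test *)

Lemma continuous_max_rectangle (f : R -> R -> R) (a b c d : R) :
  a <= b -> c <= d -> (forall x y, continuity_2d_pt f x y) ->
  exists x0 y0, a <= x0 <= b /\ c <= y0 <= d /\
    forall x y, a <= x <= b -> c <= y <= d -> f x y <= f x0 y0.
Proof.
intros Hab Hcd Hf.
assert (Hm : forall x, exists m, c <= m <= d /\ forall y, c <= y <= d -> f x y <= f x m).
{ intros x. destruct (continuity_ab_maj (f x) c d Hcd) as (m & Hm & Im).
  - intros y _. apply continuity_2d_pt_fix_fst, Hf.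
  - exists m; auto. }
destruct (functional_choice _ Hm) as [m Hm'].
set (g := fun x => f (Rmax a (Rmin b x)) (m (Rmax a (Rmin b x)))).
assert (Hcl : forall x, a <= Rmax a (Rmin b x) <= b).
{ intros x; split; [apply Rmax_l|apply Rmax_lub; [lra|apply Rmin_l]]. }
assert (Hid : forall x, a <= x <= b -> Rmax a (Rmin b x) = x).
{ intros x Hx. rewrite Rmin_right by lra. apply Rmax_right; lra. }
assert (Hlip : forall x y, Rabs (Rmax a (Rmin b x) - Rmax a (Rmin b y)) <= Rabs (x - y)).
{ intros x y. unfold Rmax, Rmin.
  repeat destruct Rle_dec; unfold Rabs; repeat destruct Rcase_abs; lra. }
assert (Hg : forall x, continuity_pt g x).
{ intros x. apply continuity_pt_eps. intros eps He.
  destruct (uniform_continuity_2d f a b c d (fun x y _ _ => Hf x y) (mkposreal eps He))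
    as [dl Hdl].
  exists dl; split; [apply cond_pos|]. intros y B. unfold g.
  set (s := Rmax a (Rmin b x)). set (t := Rmax a (Rmin b y)).
  assert (Bst : Rabs (t - s) < dl) by (eapply Rle_lt_trans; [apply Hlip|exact B]).
  pose proof (Hcl x) as Is. pose proof (Hcl y) as It. fold s in Is. fold t in It.
  destruct (Hm' s) as [I1 M1]. destruct (Hm' t) as [I2 M2].
  assert (Z : forall z, Rabs (z - z) < dl).
  { intros z. rewrite Rminus_eq_0, Rabs_R0. apply cond_pos. }
  pose proof (Hdl s (m s) t (m s) Is I1 It I1 Bst (Z _)) as K1.
  pose proof (Hdl s (m t) t (m t) Is I2 It I2 Bst (Z _)) as K2.
  simpl in K1, K2. apply Rabs_lt_between in K1. apply Rabs_lt_between in K2.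
  specialize (M1 _ I2). specialize (M2 _ I1). apply Rabs_lt_between. lra. }
destruct (continuity_ab_maj g a b Hab (fun x _ => Hg x)) as (x0 & Hx0 & Ix0).
exists x0, (m x0). destruct (Hm' x0) as [I0 _]. repeat split; try lra.
intros x y Ix Iy. specialize (Hx0 x Ix). unfold g in Hx0. rewrite !Hid in Hx0 by lra.
eapply Rle_trans; [|exact Hx0]. apply (proj2 (Hm' x)); exact Iy.
Qed.

Lemma continuity_2d_pt_Rabs (f : R -> R -> R) (x y : R) :
  continuity_2d_pt f x y -> continuity_2d_pt (fun s t => Rabs (f s t)) x y.
Proof.
intros H. apply (continuity_1d_2d_pt_comp Rabs); [|exact H]. apply Rcontinuity_abs.
Qed.

(** The continuous function [f + g + |g|] is positive, hence bounded below on the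
    rectangle: where [g] is negative, [f] is bounded below and a large multiple of
    it exceeds the bounded [-g]. The rates of all exponential barriers are chosen
    in this way. *)
Lemma large_multiple_dominates (f g : R -> R -> R) (a b c d : R) :
  a <= b -> c <= d ->
  (forall x y, continuity_2d_pt f x y) -> (forall x y, continuity_2d_pt g x y) ->
  (forall x y, a <= x <= b -> c <= y <= d -> 0 < f x y \/ (f x y = 0 /\ 0 < g x y)) ->
  exists k0, 0 < k0 /\ forall k, k0 <= k ->
    forall x y, a <= x <= b -> c <= y <= d -> 0 < k * f x y + g x y.
Proof.
intros Hab Hcd Hf Hg Hpos.
destruct (continuous_max_rectangle (fun x y => - (f x y + g x y + Rabs (g x y))) a b c d
  Hab Hcd) as (x0 & y0 & Ix0 & Iy0 & Hmin).
{ intros x y. apply continuity_2d_pt_opp.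
  repeat apply continuity_2d_pt_plus; auto. apply continuity_2d_pt_Rabs; auto. }
destruct (continuous_max_rectangle (fun x y => Rabs (g x y)) a b c d Hab Hcd)
  as (x1 & y1 & _ & _ & Hmax).
{ intros x y. apply continuity_2d_pt_Rabs; auto. }
set (m := f x0 y0 + g x0 y0 + Rabs (g x0 y0)).
set (K := Rabs (g x1 y1)).
assert (Hm : 0 < m).
{ unfold m. pose proof (Rabs_maj2 (g x0 y0)) as B.
  destruct (Hpos x0 y0 Ix0 Iy0) as [H|[H1 H2]]; [lra|].
  pose proof (Rabs_pos (g x0 y0)). lra. }
assert (HK : 0 <= K) by apply Rabs_pos.
exists (2 * (K + 1) / m). split; [apply Rdiv_lt_0_compat; lra|].
intros k Hk x y Ix Iy. specialize (Hmin x y Ix Iy). specialize (Hmax x y Ix Iy).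
simpl in Hmin, Hmax. fold K in Hmax.
assert (Hmin' : m <= f x y + g x y + Rabs (g x y)) by (unfold m; lra).
assert (Hk0 : 0 < 2 * (K + 1) / m) by (apply Rdiv_lt_0_compat; lra).
assert (Hf0 : 0 <= f x y) by (destruct (Hpos x y Ix Iy); lra).
destruct (Rle_dec 0 (g x y)) as [G|G].
- destruct (Hpos x y Ix Iy) as [H|[H1 H2]]; [|rewrite H1; lra].
  assert (0 < k * f x y) by (apply Rmult_lt_0_compat; lra). lra.
- rewrite (Rabs_left (g x y)) in Hmin', Hmax by lra.
  assert (2 * (K + 1) / m * m <= k * f x y).
  { apply Rmult_le_compat; lra. }
  replace (2 * (K + 1) / m * m) with (2 * (K + 1)) in H by (field; lra). lra.
Qed.

Lemma second_derivative_test (g g' : R -> R) (l x0 d : R) :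
  0 < d -> (forall x, Rabs (x - x0) < d -> is_derive g x (g' x)) ->
  is_derive g' x0 l -> (forall x, Rabs (x - x0) < d -> g x <= g x0) ->
  g' x0 = 0 /\ l <= 0.
Proof.
intros Hd Hg Hl Hmax.
assert (Z : g' x0 = 0).
{ assert (H0 : derivable_pt_lim g x0 (g' x0)).
  { apply is_derive_Reals, Hg. rewrite Rminus_eq_0, Rabs_R0; exact Hd. }
  pose (pr := exist _ (g' x0) H0 : derivable_pt g x0).
  replace (g' x0) with (derive_pt g x0 pr) by reflexivity.
  apply (deriv_maximum g (x0 - d) (x0 + d)); try lra.
  intros x H1 H2. apply Hmax. apply Rabs_lt_between; lra. }
split; [exact Z|].
destruct (Rle_dec l 0) as [|N]; [assumption|exfalso].
(* [l > 0] makes [g'] positive just to the right of [x0], so [g] increases there *)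
apply is_derive_Reals in Hl.
destruct (Hl (l / 2) ltac:(lra)) as [e He]. pose proof (cond_pos e) as He0.
set (t := Rmin d e / 2).
assert (0 < t /\ t < d /\ t < e).
{ unfold t. pose proof (Rmin_l d e). pose proof (Rmin_r d e).
  assert (0 < Rmin d e) by (apply Rmin_glb_lt; lra). lra. }
destruct (MVT_cor2 g g' x0 (x0 + t)) as (c & Ec & Hc); [lra| |].
- intros c Hc. apply is_derive_Reals, Hg. rewrite Rabs_pos_eq; lra.
- specialize (He (c - x0) ltac:(lra)). rewrite (Rabs_pos_eq (c - x0)) in He by lra.
  specialize (He ltac:(lra)). replace (x0 + (c - x0)) with c in He by ring.
  rewrite Z in He. apply Rabs_lt_between in He.
  assert (0 < g' c).
  { assert (E : (g' c - 0) / (c - x0) * (c - x0) = g' c) by (field; lra).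
    rewrite <- E. apply Rmult_lt_0_compat; lra. }
  specialize (Hmax (x0 + t)). replace (x0 + t - x0) with t in * by ring.
  rewrite (Rabs_pos_eq t) in Hmax by lra. specialize (Hmax ltac:(lra)). nra.
Qed.

(** * Maximum principle on the cylinder for an operator degenerating at the exit *)

(** The circle [x = 1] plays the part of a sonic circle: ellipticity in [x] is
    lost there, but the first order part points into the domain. The derivatives
    of [P] are parameters, so that those in [x] may be one-sided at the ends. *)
Record degenerate_elliptic (A C B1 B2 P P1 P2 P11 P22 : R -> R -> R) : Prop := {
  de_A : forall x y, 0 <= x < 1 -> 0 < A x y;
  de_A1 : forall y, A 1 y = 0;
  de_C : forall x y, 0 <= x < 1 -> 0 < C x y;
  de_B1 : forall y, B1 1 y < 0;
  de_A_cont : forall x y, continuity_2d_pt A x y;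
  de_C_cont : forall x y, continuity_2d_pt C x y;
  de_B1_cont : forall x y, continuity_2d_pt B1 x y;
  de_B2_cont : forall x y, continuity_2d_pt B2 x y;
  de_P_cont : forall x y, continuity_2d_pt P x y;
  de_periodic : forall x, periodic (P x);
  de_P1 : forall x y, I01 x -> is_derive01 (fun t => P t y) x (P1 x y);
  de_P2 : forall x y, 0 < x < 1 -> is_derive (P x) y (P2 x y);
  de_P11 : forall x y, 0 < x < 1 -> is_derive (fun t => P1 t y) x (P11 x y);
  de_P22 : forall x y, 0 < x < 1 -> is_derive (P2 x) y (P22 x y);
  de_eq : forall x y, 0 < x < 1 ->
    A x y * P11 x y + C x y * P22 x y + B1 x y * P1 x y + B2 x y * P2 x y = 0
}.

Lemma periodic_shift_Z (f : R -> R) :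
  periodic f -> forall (k : Z) y, f (y + IZR k * (2 * PI)) = f y.
Proof.
intros Hf.
assert (Hn : forall (k : nat) y, f (y + INR k * (2 * PI)) = f y).
{ induction k as [|k IH]; intros y.
  - simpl. f_equal; ring.
  - rewrite S_INR. replace (y + (INR k + 1) * (2 * PI)) with (y + INR k * (2 * PI) + 2 * PI) by ring.
    rewrite Hf; apply IH. }
intros k y. destruct (Z_le_gt_dec 0 k) as [H|H].
- destruct (IZN k) as [m ->]; [exact H|]. rewrite <- INR_IZR_INZ. apply Hn.
- destruct (IZN (- k)) as [m Hm]; [auto with zarith|].
  rewrite <- (Hn m). f_equal. rewrite INR_IZR_INZ, <- Hm, opp_IZR. ring.
Qed.

Lemma periodic_representative (y : R) :
  exists k : Z, 0 <= y + IZR k * (2 * PI) <= 2 * PI.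
Proof.
pose proof PI_RGT_0 as HP.
destruct (archimed (y / (2 * PI))) as [H1 H2].
exists (1 - up (y / (2 * PI)))%Z. rewrite minus_IZR.
assert (E : y = y / (2 * PI) * (2 * PI)) by (field; lra).
set (q := y / (2 * PI)) in *. clearbody q. rewrite E. split; nra.
Qed.

Lemma periodic_max (f : R -> R -> R) (a b : R) :
  a <= b -> (forall x y, continuity_2d_pt f x y) -> (forall x, periodic (f x)) ->
  exists x0 y0, a <= x0 <= b /\ 0 <= y0 <= 2 * PI /\
    forall x y, a <= x <= b -> f x y <= f x0 y0.
Proof.
intros Hab Hf Hp. pose proof PI_RGT_0 as HP.
destruct (continuous_max_rectangle f a b 0 (2 * PI)) as (x0 & y0 & Ix & Iy & Hm); auto; [lra|].
exists x0, y0; split; [exact Ix|split; [exact Iy|]]. intros x y Hx.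
destruct (periodic_representative y) as [k Hk].
rewrite <- (periodic_shift_Z (f x) (Hp x) k). apply Hm; assumption.
Qed.

(** The barriers below are strict supersolutions, so this contradicts them at a
    point where [P - W] is maximal. The operator has no mixed derivative, so
    maxima along the two coordinate lines are enough. *)
Lemma barrier_not_touched (A C B1 B2 P P1 P2 P11 P22 W W1 W2 W11 W22 : R -> R -> R)
    (x0 y0 d : R) :
  degenerate_elliptic A C B1 B2 P P1 P2 P11 P22 ->
  (forall x y, is_derive (fun t => W t y) x (W1 x y)) ->
  (forall x y, is_derive (W x) y (W2 x y)) ->
  (forall x y, is_derive (fun t => W1 t y) x (W11 x y)) ->
  (forall x y, is_derive (W2 x) y (W22 x y)) ->
  0 < x0 < 1 -> 0 < d ->
  (forall x, Rabs (x - x0) < d -> P x y0 - W x y0 <= P x0 y0 - W x0 y0) ->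
  (forall y, Rabs (y - y0) < d -> P x0 y - W x0 y <= P x0 y0 - W x0 y0) ->
  0 <= A x0 y0 * W11 x0 y0 + C x0 y0 * W22 x0 y0
       + B1 x0 y0 * W1 x0 y0 + B2 x0 y0 * W2 x0 y0.
Proof.
intros H D1 D2 D11 D22 Hx Hd Mx My.
assert (Hd' : 0 < Rmin d (Rmin x0 (1 - x0))) by (repeat apply Rmin_glb_lt; lra).
pose proof (Rmin_l d (Rmin x0 (1 - x0))). pose proof (Rmin_r d (Rmin x0 (1 - x0))).
pose proof (Rmin_l x0 (1 - x0)). pose proof (Rmin_r x0 (1 - x0)).
destruct (second_derivative_test (fun x => P x y0 - W x y0) (fun x => P1 x y0 - W1 x y0)
  (P11 x0 y0 - W11 x0 y0) x0 _ Hd') as [E1 L1].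
- intros x B. apply Rabs_lt_between in B.
  apply (is_derive_minus (fun x => P x y0) (fun x => W x y0)); [|apply D1].
  apply is_derive01_is_derive; [lra|]. apply (de_P1 _ _ _ _ _ _ _ _ _ H). unfold I01; lra.
- apply (is_derive_minus (fun x => P1 x y0) (fun x => W1 x y0)); [|apply D11].
  apply (de_P11 _ _ _ _ _ _ _ _ _ H); exact Hx.
- intros x B. apply Mx; lra.
- destruct (second_derivative_test (fun y => P x0 y - W x0 y) (fun y => P2 x0 y - W2 x0 y)
    (P22 x0 y0 - W22 x0 y0) y0 d Hd) as [E2 L2].
  + intros y B. apply (is_derive_minus (P x0) (W x0)); [|apply D2].
    apply (de_P2 _ _ _ _ _ _ _ _ _ H); exact Hx.
  + apply (is_derive_minus (P2 x0) (W2 x0)); [|apply D22].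
    apply (de_P22 _ _ _ _ _ _ _ _ _ H); exact Hx.
  + exact My.
  + pose proof (de_eq _ _ _ _ _ _ _ _ _ H x0 y0 Hx) as E.
    pose proof (de_A _ _ _ _ _ _ _ _ _ H x0 y0 ltac:(lra)) as HA.
    pose proof (de_C _ _ _ _ _ _ _ _ _ H x0 y0 ltac:(lra)) as HC.
    replace (W1 x0 y0) with (P1 x0 y0) by lra. replace (W2 x0 y0) with (P2 x0 y0) by lra.
    assert (0 <= A x0 y0 * (W11 x0 y0 - P11 x0 y0)) by (apply Rmult_le_pos; lra).
    assert (0 <= C x0 y0 * (W22 x0 y0 - P22 x0 y0)) by (apply Rmult_le_pos; lra).
    lra.
Qed.

Lemma comparison_radial (A C B1 B2 P P1 P2 P11 P22 : R -> R -> R) (W W' W'' : R -> R)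
    (lo hi : R) :
  degenerate_elliptic A C B1 B2 P P1 P2 P11 P22 ->
  (forall x, is_derive W x (W' x)) -> (forall x, is_derive W' x (W'' x)) ->
  0 <= lo -> lo < hi -> hi <= 1 ->
  (forall x y, lo < x < hi -> 0 <= y <= 2 * PI -> A x y * W'' x + B1 x y * W' x < 0) ->
  (forall y, P lo y <= W lo) -> (forall y, P hi y <= W hi) ->
  forall x y, lo <= x <= hi -> P x y <= W x.
Proof.
intros H D1 D11 H0 Hlh H1 HL Hlo Hhi.
destruct (periodic_max (fun x y => P x y - W x) lo hi) as (x0 & y0 & Ix & Iy & Hm); [lra| | |].
- intros x y. apply continuity_2d_pt_minus; [apply (de_P_cont _ _ _ _ _ _ _ _ _ H)|].
  apply continuity_2d_pt_fst. exact (is_derive_continuity_pt _ _ _ (D1 x)).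
- intros x y. rewrite (de_periodic _ _ _ _ _ _ _ _ _ H x y). reflexivity.
- destruct (Rle_dec (P x0 y0 - W x0) 0) as [L|N].
  + intros x y Hx. specialize (Hm x y Hx). lra.
  + exfalso.
    assert (x0 <> lo) by (intros ->; specialize (Hlo y0); lra).
    assert (x0 <> hi) by (intros ->; specialize (Hhi y0); lra).
    pose proof (barrier_not_touched A C B1 B2 P P1 P2 P11 P22 (fun x _ => W x)
      (fun x _ => W' x) (fun _ _ => 0) (fun x _ => W'' x) (fun _ _ => 0) x0 y0
      (Rmin (x0 - lo) (hi - x0)) H) as T. simpl in T.
    pose proof (Rmin_l (x0 - lo) (hi - x0)). pose proof (Rmin_r (x0 - lo) (hi - x0)).
    specialize (T ltac:(intros; apply D1) ltac:(intros; apply @is_derive_const)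
      ltac:(intros; apply D11) ltac:(intros; apply @is_derive_const) ltac:(lra)
      ltac:(apply Rmin_glb_lt; lra)
      ltac:(intros x B; apply Rabs_lt_between in B; apply Hm; lra)
      ltac:(intros y B; apply Hm; lra)).
    specialize (HL x0 y0 ltac:(lra) Iy). lra.
Qed.

(** Hopf's boundary point lemma at [xm] for the strip between [xm] and [x1]. The
    barrier is [M - e (exp (a |x - xm|) - 1)]: for large [a] its second order
    part dominates where the operator is elliptic, and at the exit, where the
    second order part vanishes, the sign of [B1] does the work. *)
Lemma hopf (A C B1 B2 P P1 P2 P11 P22 : R -> R -> R) (M xm x1 y0 : R) :
  degenerate_elliptic A C B1 B2 P P1 P2 P11 P22 ->
  I01 xm -> 0 <= x1 < 1 -> xm <> x1 ->
  (forall x y, I01 x -> P x y <= M) -> P xm y0 = M -> (forall y, P x1 y < M) ->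
  0 < (xm - x1) * P1 xm y0.
Proof.
intros H Im I1 Hne HM Hm HlM. unfold I01 in Im.
set (sg := if Rlt_dec xm x1 then 1 else -1).
assert (Hsg : (sg = 1 /\ xm < x1) \/ (sg = -1 /\ x1 < xm)).
{ unfold sg. destruct (Rlt_dec xm x1); [left|right]; split; lra. }
clearbody sg.
assert (Habs : sg * (x1 - xm) > 0) by (destruct Hsg as [[-> ?]|[-> ?]]; lra).
set (lo := Rmin xm x1). set (hi := Rmax xm x1).
assert (Hlh : 0 <= lo /\ lo < hi /\ hi <= 1).
{ unfold lo, hi, Rmin, Rmax. destruct Rle_dec; lra. }
pose proof PI_RGT_0 as HPI.
destruct (large_multiple_dominates A (fun x y => sg * B1 x y) lo hi 0 (2 * PI))
  as (a & Ha & HaL); [lra|lra|apply (de_A_cont _ _ _ _ _ _ _ _ _ H)| | |].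
{ intros x y. apply continuity_2d_pt_mult; [apply continuity_2d_pt_const|].
  apply (de_B1_cont _ _ _ _ _ _ _ _ _ H). }
{ intros x y Hx _. destruct (Req_dec x 1) as [->|Nx].
  - right. split; [apply (de_A1 _ _ _ _ _ _ _ _ _ H)|].
    pose proof (de_B1 _ _ _ _ _ _ _ _ _ H y). destruct Hsg as [[-> ?]|[-> ?]]; [|lra].
    exfalso. unfold hi in Hx. rewrite Rmax_right in Hx; lra.
  - left. apply (de_A _ _ _ _ _ _ _ _ _ H). lra. }
specialize (HaL a (Rle_refl a)).
destruct (periodic_max P x1 x1) as (x2 & y2 & Ix2 & _ & Hy2); [lra| | |].
{ apply (de_P_cont _ _ _ _ _ _ _ _ _ H). }
{ apply (de_periodic _ _ _ _ _ _ _ _ _ H). }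
replace x2 with x1 in Hy2 by lra.
set (eta := M - P x1 y2). assert (Heta : 0 < eta) by (unfold eta; specialize (HlM y2); lra).
assert (Hexp : 1 < exp (a * (sg * (x1 - xm)))).
{ rewrite <- exp_0. apply exp_increasing. apply Rmult_lt_0_compat; lra. }
set (e := eta / (exp (a * (sg * (x1 - xm))) - 1)).
assert (He : 0 < e) by (apply Rdiv_lt_0_compat; lra).
set (W := fun x => M - e * (exp (a * (sg * (x - xm))) - 1)).
set (W' := fun x => - e * (a * sg) * exp (a * (sg * (x - xm)))).
set (W'' := fun x => - e * (a * sg) ^ 2 * exp (a * (sg * (x - xm)))).
assert (D1 : forall x, is_derive W x (W' x)).
{ intros x. unfold W, W'. auto_derive; [trivial|unfold Rminus; ring]. }
assert (D11 : forall x, is_derive W' x (W'' x)).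
{ intros x. unfold W', W''. auto_derive; [trivial|unfold Rminus; ring]. }
assert (Wm : W xm = M).
{ unfold W. rewrite Rminus_eq_0, !Rmult_0_r, exp_0. ring. }
assert (W1 : W x1 = P x1 y2).
{ unfold W, e, eta. field. lra. }
clearbody e.
assert (HP : forall x y, lo <= x <= hi -> P x y <= W x).
{ apply (comparison_radial A C B1 B2 P P1 P2 P11 P22 W W' W''); try lra; auto.
  - intros x y Hx Iy. specialize (HaL x y ltac:(lra) Iy). unfold W', W''.
    assert (Hs2 : sg ^ 2 = 1) by (destruct Hsg as [[-> ?]|[-> ?]]; ring).
    replace (A x y * (- e * (a * sg) ^ 2 * exp (a * (sg * (x - xm)))) +
      B1 x y * (- e * (a * sg) * exp (a * (sg * (x - xm)))))
      with (- (e * a * exp (a * (sg * (x - xm))) * (a * sg ^ 2 * A x y + sg * B1 x y))) by ring.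
    rewrite Hs2, Rmult_1_r. apply Ropp_lt_gt_0_contravar.
    repeat apply Rmult_lt_0_compat; try lra. apply exp_pos.
  - intros y. unfold lo, Rmin. destruct Rle_dec.
    + rewrite Wm. apply HM; exact Im.
    + rewrite W1. apply Hy2; lra.
  - intros y. unfold hi, Rmax. destruct Rle_dec.
    + rewrite W1. apply Hy2; lra.
    + rewrite Wm. apply HM; exact Im. }
assert (Wd : W' xm = - e * (a * sg)).
{ unfold W'. rewrite Rminus_eq_0, !Rmult_0_r, exp_0. ring. }
pose proof (de_P1 _ _ _ _ _ _ _ _ _ H xm y0 Im) as DP.
pose proof (is_derive_is_derive01 W xm _ Im (D1 xm)) as DW.
assert (Hea : 0 < e * a) by (apply Rmult_lt_0_compat; lra).
destruct Hsg as [[-> L]|[-> L]].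
- assert (Hle : P1 xm y0 <= W' xm).
  { apply (is_derive01_le_right (fun t => P t y0) W xm _ _ (x1 - xm)); try lra; auto.
    intros t Ht. apply HP. unfold lo, hi. rewrite Rmin_left, Rmax_right; lra. }
  nra.
- assert (Hle : W' xm <= P1 xm y0).
  { apply (is_derive01_le_left (fun t => P t y0) W xm _ _ (xm - x1)); try lra; auto.
    intros t Ht. apply HP. unfold lo, hi. rewrite Rmin_right, Rmax_left; lra. }
  nra.
Qed.

(** Strong maximum principle along a circle. A thin strip around it, cut open at
    [y1], carries the barrier [M - e g(x) exp (-k (y - y1))] with a bump [g]: the
    gap to [M] decays in [y] without ever closing, and by periodicity the value
    at [y1] controls both ends of the strip. *)
Lemma below_max_propagates (A C B1 B2 P P1 P2 P11 P22 : R -> R -> R) (M x1 y1 : R) :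
  degenerate_elliptic A C B1 B2 P P1 P2 P11 P22 ->
  0 < x1 < 1 -> (forall x y, I01 x -> P x y <= M) -> P x1 y1 < M ->
  forall y, P x1 y < M.
Proof.
intros H I1 HM Hlt. pose proof PI_RGT_0 as HPI.
assert (Hperiod := de_periodic _ _ _ _ _ _ _ _ _ H).
set (eta := (M - P x1 y1) / 2). assert (Heta : 0 < eta) by (unfold eta; lra).
destruct (proj1 (continuity_pt_eps (fun s => P s y1) x1)
  (continuity_2d_pt_fix_snd P x1 y1 (de_P_cont _ _ _ _ _ _ _ _ _ H x1 y1)) eta Heta)
  as (d & Hd & Hdy).
set (h := Rmin (d / 2) (Rmin (x1 / 2) ((1 - x1) / 2))).
assert (Hh : 0 < h /\ h < d /\ h < x1 /\ h < 1 - x1).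
{ unfold h. pose proof (Rmin_l (d / 2) (Rmin (x1 / 2) ((1 - x1) / 2))).
  pose proof (Rmin_r (d / 2) (Rmin (x1 / 2) ((1 - x1) / 2))).
  pose proof (Rmin_l (x1 / 2) ((1 - x1) / 2)). pose proof (Rmin_r (x1 / 2) ((1 - x1) / 2)).
  repeat split; try lra. repeat apply Rmin_glb_lt; lra. }
clearbody h.
assert (Hside : forall x, x1 - h <= x <= x1 + h -> P x y1 <= M - eta).
{ intros x Hx. specialize (Hdy x ltac:(apply Rabs_lt_between; lra)).
  apply Rabs_lt_between in Hdy. unfold eta in *. lra. }
set (g := fun x => (h ^ 2 - (x - x1) ^ 2) ^ 2).
set (g' := fun x => - 4 * (x - x1) * (h ^ 2 - (x - x1) ^ 2)).
set (g'' := fun x => 12 * (x - x1) ^ 2 - 4 * h ^ 2).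
assert (Dg : forall x, is_derive g x (g' x)).
{ intros x. unfold g, g'. auto_derive; [trivial|ring]. }
assert (Dg' : forall x, is_derive g' x (g'' x)).
{ intros x. unfold g', g''. auto_derive; [trivial|ring]. }
assert (Dg'' : forall x, is_derive g'' x (24 * (x - x1))).
{ intros x. unfold g''. auto_derive; [trivial|ring]. }
assert (Cont : forall (w w' : R -> R), (forall x, is_derive w x (w' x)) ->
  forall x y, continuity_2d_pt (fun s _ => w s) x y).
{ intros w w' Dw x y. apply continuity_2d_pt_fst.
  exact (is_derive_continuity_pt _ _ _ (Dw x)). }
assert (Cg := Cont _ _ Dg). assert (Cg' := Cont _ _ Dg'). assert (Cg'' := Cont _ _ Dg'').
clear Cont.
assert (Hin : forall x, x1 - h <= x <= x1 + h -> 0 <= h ^ 2 - (x - x1) ^ 2).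
{ intros x Hx. nra. }
destruct (large_multiple_dominates C (fun x y => - B2 x y) (x1 - h) (x1 + h) y1 (y1 + 2 * PI))
  as (a & Ha & HaL); [lra|lra|apply (de_C_cont _ _ _ _ _ _ _ _ _ H)| | |].
{ intros x y. apply continuity_2d_pt_opp. apply (de_B2_cont _ _ _ _ _ _ _ _ _ H). }
{ intros x y Hx _. left. apply (de_C _ _ _ _ _ _ _ _ _ H). lra. }
specialize (HaL a (Rle_refl a)).
(* on the sides of the strip [g] and [g'] vanish while [g''] is positive *)
destruct (large_multiple_dominates (fun x y => C x y * g x)
  (fun x y => A x y * g'' x + B1 x y * g' x) (x1 - h) (x1 + h) y1 (y1 + 2 * PI))
  as (b & Hb & HbL); [lra|lra| | | |].
{ intros x y. apply continuity_2d_pt_mult; [apply (de_C_cont _ _ _ _ _ _ _ _ _ H)|apply Cg]. }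
{ intros x y. apply continuity_2d_pt_plus; apply continuity_2d_pt_mult;
  [apply (de_A_cont _ _ _ _ _ _ _ _ _ H)|apply Cg''|apply (de_B1_cont _ _ _ _ _ _ _ _ _ H)|apply Cg']. }
{ intros x y Hx _.
  pose proof (de_C _ _ _ _ _ _ _ _ _ H x y ltac:(lra)) as HC.
  pose proof (de_A _ _ _ _ _ _ _ _ _ H x y ltac:(lra)) as HA.
  destruct (Req_dec (h ^ 2 - (x - x1) ^ 2) 0) as [E|E].
  - right. unfold g, g', g''. rewrite E. split; [ring|].
    replace ((x - x1) ^ 2) with (h ^ 2) by lra.
    assert (0 < h ^ 2) by (apply pow_lt; lra). nra.
  - left. apply Rmult_lt_0_compat; [exact HC|]. unfold g. apply pow_lt.
    specialize (Hin x Hx). lra. }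
specialize (HbL b (Rle_refl b)).
set (k := a + b + 1).
assert (Hh4 : 0 < h ^ 4) by (apply pow_lt; lra).
set (e := eta / h ^ 4). assert (He : 0 < e) by (apply Rdiv_lt_0_compat; lra).
set (E := fun y => exp (- k * (y - y1))).
assert (HE : forall y, 0 < E y) by (intros y; apply exp_pos).
set (W := fun x y => M - e * g x * E y).
set (W1 := fun x y => - e * g' x * E y).
set (W2 := fun x y => e * k * g x * E y).
set (W11 := fun x y => - e * g'' x * E y).
set (W22 := fun x y => - e * k ^ 2 * g x * E y).
assert (DE : forall c y, is_derive (fun t => c * E t) y (- (c * k) * E y)).
{ intros c y. unfold E. auto_derive; [trivial|unfold Rminus; ring]. }
assert (Dx : forall w w' c x, is_derive w x w' -> is_derive (fun t => - e * w t * c) x (- e * w' * c)).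
{ intros w w' c x Dw.
  apply is_derive_ext with (fun t => (- e * c) * w t); [intros; simpl; ring|].
  replace (- e * w' * c) with ((- e * c) * w') by ring. apply is_derive_scal; exact Dw. }
assert (D1 : forall x y, is_derive (fun t => W t y) x (W1 x y)).
{ intros x y. unfold W, W1.
  apply is_derive_ext with (fun t => plus M (- e * g t * E y)); [intros; unfold plus; simpl; ring|].
  replace (- e * g' x * E y) with (plus 0 (- e * g' x * E y)) by (unfold plus; simpl; ring).
  apply @is_derive_plus; [apply @is_derive_const|apply Dx, Dg]. }
assert (D2 : forall x y, is_derive (W x) y (W2 x y)).
{ intros x y. unfold W, W2.
  apply is_derive_ext with (fun t => plus M ((- e * g x) * E t)); [intros; unfold plus; simpl; ring|].
  replace (e * k * g x * E y) with (plus 0 (- ((- e * g x) * k) * E y)) by (unfold plus; simpl; ring).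
  apply @is_derive_plus; [apply @is_derive_const|apply DE]. }
assert (D11 : forall x y, is_derive (fun t => W1 t y) x (W11 x y)).
{ intros x y. unfold W1, W11. apply Dx, Dg'. }
assert (D22 : forall x y, is_derive (W2 x) y (W22 x y)).
{ intros x y. unfold W2, W22.
  replace (- e * k ^ 2 * g x * E y) with (- ((e * k * g x) * k) * E y) by ring. apply DE. }
assert (HP : forall x y, x1 - h <= x <= x1 + h -> y1 <= y <= y1 + 2 * PI -> P x y <= W x y).
{ destruct (continuous_max_rectangle (fun x y => P x y - W x y) (x1 - h) (x1 + h) y1 (y1 + 2 * PI))
    as (x0 & y0 & Ix & Iy & Hm); [lra|lra| |].
  { intros x y. apply continuity_2d_pt_minus; [apply (de_P_cont _ _ _ _ _ _ _ _ _ H)|].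
    unfold W. apply continuity_2d_pt_minus; [apply continuity_2d_pt_const|].
    apply continuity_2d_pt_mult; [apply continuity_2d_pt_mult; [apply continuity_2d_pt_const|apply Cg]|].
    apply (continuity_1d_2d_pt_comp E (fun _ t => t)); [|apply continuity_2d_pt_id2].
    apply (is_derive_continuity_pt _ _ (- k * E y)).
    apply is_derive_ext with (fun t => 1 * E t); [intros; simpl; ring|].
    replace (- k * E y) with (- (1 * k) * E y) by ring. apply DE. }
  destruct (Rle_dec (P x0 y0 - W x0 y0) 0) as [L|N].
  { intros x y Hx Hy. specialize (Hm x y Hx Hy). lra. }
  exfalso.
  assert (Hsides : forall x y, h ^ 2 - (x - x1) ^ 2 = 0 -> W x y = M).
  { intros x y Ez. unfold W, g. rewrite Ez. ring. }
  assert (Hends : forall x, x1 - h <= x <= x1 + h -> forall y, y1 <= y -> M - eta <= W x y).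
  { intros x Hx y Hy. unfold W.
    assert (E y <= 1).
    { unfold E. rewrite <- exp_0. destruct (Req_dec y y1) as [->|].
      - right. f_equal. ring.
      - left. apply exp_increasing. unfold k. nra. }
    assert (0 <= g x <= h ^ 4).
    { unfold g. specialize (Hin x Hx). replace (h ^ 4) with ((h ^ 2) ^ 2) by ring. split.
      - apply pow_le; exact Hin.
      - apply pow_incr. split; [exact Hin|]. pose proof (pow2_ge_0 (x - x1)). lra. }
    assert (e * g x * E y <= eta); [|lra].
    replace eta with (e * h ^ 4 * 1) by (unfold e; field; lra).
    specialize (HE y). apply Rmult_le_compat; try lra.
    - apply Rmult_le_pos; lra.
    - apply Rmult_le_compat_l; lra. }
  assert (x0 <> x1 - h).
  { intros ->. rewrite Hsides in N by ring. specialize (HM (x1 - h) y0 ltac:(unfold I01; lra)). lra. }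
  assert (x0 <> x1 + h).
  { intros ->. rewrite Hsides in N by ring. specialize (HM (x1 + h) y0 ltac:(unfold I01; lra)). lra. }
  pose proof (Hends x0 Ix) as He0. pose proof (Hside x0 Ix) as Hs0.
  assert (y0 <> y1).
  { intros ->. specialize (He0 y1 ltac:(lra)). lra. }
  assert (y0 <> y1 + 2 * PI).
  { intros ->. specialize (He0 (y1 + 2 * PI) ltac:(lra)). rewrite Hperiod in N. lra. }
  set (r := Rmin (Rmin (x0 - (x1 - h)) (x1 + h - x0)) (Rmin (y0 - y1) (y1 + 2 * PI - y0))).
  assert (Hr : 0 < r /\ r <= x0 - (x1 - h) /\ r <= x1 + h - x0 /\ r <= y0 - y1
    /\ r <= y1 + 2 * PI - y0).
  { unfold r. repeat split.
    - repeat apply Rmin_glb_lt; lra.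
    - eapply Rle_trans; apply Rmin_l.
    - eapply Rle_trans; [apply Rmin_l|apply Rmin_r].
    - eapply Rle_trans; [apply Rmin_r|apply Rmin_l].
    - eapply Rle_trans; apply Rmin_r. }
  clearbody r.
  pose proof (barrier_not_touched A C B1 B2 P P1 P2 P11 P22 W W1 W2 W11 W22 x0 y0 r H
    D1 D2 D11 D22 ltac:(lra) ltac:(lra)
    ltac:(intros x B; apply Rabs_lt_between in B; apply Hm; lra)
    ltac:(intros y B; apply Rabs_lt_between in B; apply Hm; lra)) as T.
  specialize (HaL x0 y0 Ix Iy). specialize (HbL x0 y0 Ix Iy). simpl in HaL, HbL.
  pose proof (de_C _ _ _ _ _ _ _ _ _ H x0 y0 ltac:(lra)) as HC.
  assert (Hg : 0 <= g x0) by (apply pow_le, Hin, Ix).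
  revert T. unfold W1, W2, W11, W22.
  replace (A x0 y0 * (- e * g'' x0 * E y0) + C x0 y0 * (- e * k ^ 2 * g x0 * E y0) +
    B1 x0 y0 * (- e * g' x0 * E y0) + B2 x0 y0 * (e * k * g x0 * E y0))
    with (- (e * E y0 * ((k * (k * C x0 y0 - B2 x0 y0)) * g x0
            + (A x0 y0 * g'' x0 + B1 x0 y0 * g' x0)))) by ring.
  assert (Hq : b * C x0 y0 <= k * (k * C x0 y0 - B2 x0 y0)).
  { assert (b * C x0 y0 <= k * C x0 y0 - B2 x0 y0) by (unfold k; nra).
    assert (0 < b * C x0 y0) by (apply Rmult_lt_0_compat; lra).
    unfold k at 1. nra. }
  apply Rmult_le_compat_r with (r := g x0) in Hq; [|exact Hg].
  assert (0 < e * E y0 * ((k * (k * C x0 y0 - B2 x0 y0)) * g x0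
            + (A x0 y0 * g'' x0 + B1 x0 y0 * g' x0))).
  { apply Rmult_lt_0_compat; [apply Rmult_lt_0_compat; [lra|apply HE]|]. lra. }
  lra. }
intros y. destruct (periodic_representative (y - y1)) as [z Hz].
rewrite <- (periodic_shift_Z (P x1) (Hperiod x1) z).
eapply Rle_lt_trans; [apply HP; lra|]. unfold W.
specialize (HE (y + IZR z * (2 * PI))).
assert (0 < g x1) by (unfold g; replace (h ^ 2 - (x1 - x1) ^ 2) with (h ^ 2) by ring;
  apply pow_lt, pow_lt; lra).
assert (0 < e * g x1 * E (y + IZR z * (2 * PI))).
{ apply Rmult_lt_0_compat; [apply Rmult_lt_0_compat; lra|exact HE]. }
lra.
Qed.

(** The maximum is attained on every circle, since otherwise the Hopf lemma gives
    a strict derivative at a maximum point, excluded at interior points and, by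
    hypothesis, at both ends; by propagation the solution is then constant. *)
Theorem max_principle_constant (A C B1 B2 P P1 P2 P11 P22 : R -> R -> R) :
  degenerate_elliptic A C B1 B2 P P1 P2 P11 P22 ->
  (forall y, P1 1 y = 0) ->
  (forall y, (forall x z, I01 x -> P x z <= P 0 y) -> 0 <= P1 0 y) ->
  exists M, forall x y, I01 x -> P x y = M.
Proof.
intros H Hexit Hentry.
destruct (periodic_max P 0 1) as (xm & ym & Ixm & _ & HM); [lra| | |].
{ apply (de_P_cont _ _ _ _ _ _ _ _ _ H). }
{ apply (de_periodic _ _ _ _ _ _ _ _ _ H). }
exists (P xm ym).
assert (Hline : forall x1, 0 < x1 < 1 -> exists y, P xm ym <= P x1 y).
{ intros x1 Hx1. apply NNPP. intros N.
  assert (Hlt : forall y, P x1 y < P xm ym).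
  { intros y. apply Rnot_le_lt. intros L. apply N. exists y; exact L. }
  assert (Hne : xm <> x1) by (intros E; specialize (Hlt ym); rewrite E in Hlt; lra).
  pose proof (hopf A C B1 B2 P P1 P2 P11 P22 (P xm ym) xm x1 ym H Ixm ltac:(lra) Hne HM
    eq_refl Hlt) as T.
  destruct (Req_dec xm 0) as [E0|E0]; [|destruct (Req_dec xm 1) as [E1|E1]].
  - rewrite E0 in *. specialize (Hentry ym HM). nra.
  - rewrite E1 in *. rewrite Hexit in T. lra.
  - pose proof (de_P1 _ _ _ _ _ _ _ _ _ H xm ym Ixm) as DP.
    pose proof (is_derive01_const (P xm ym) xm Ixm) as DC.
    assert (P1 xm ym <= 0).
    { apply (is_derive01_le_right (fun t => P t ym) (fun _ => P xm ym) xm _ _ (1 - xm));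
        try lra; auto.
      intros t Ht. apply HM. unfold I01; lra. }
    assert (0 <= P1 xm ym).
    { apply (is_derive01_le_left (fun t => P t ym) (fun _ => P xm ym) xm _ _ xm);
        try lra; auto.
      intros t Ht. apply HM. unfold I01; lra. }
    nra. }
intros x y Hx. apply Rminus_diag_uniq.
apply (continuity_zero_closed (fun s => P s y - P xm ym)); [| |exact Hx].
- intros s. apply continuity_pt_minus; [|apply continuity_pt_const; intros ? ?; reflexivity].
  apply (continuity_2d_pt_fix_snd P), (de_P_cont _ _ _ _ _ _ _ _ _ H).
- intros s Hs. apply Rminus_diag_eq. apply Rle_antisym; [apply HM; unfold I01; lra|].
  apply Rnot_lt_le. intros L.
  destruct (Hline s Hs) as [z Hz].
  pose proof (below_max_propagates A C B1 B2 P P1 P2 P11 P22 (P xm ym) s y H Hs HM L z). lra.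
Qed.

(** * Mean values and implicit functions *)

Lemma continuous01_interior (f : R -> R) (x : R) :
  0 < x < 1 -> continuous01 f x -> continuity_pt f x.
Proof.
intros Hx H. apply continuity_pt_locally. intros eps.
unfold continuous01 in H. rewrite filterlim_locally in H. specialize (H eps).
generalize (filter_and _ _ (locally_interior x Hx) H). apply filter_imp.
intros t [It Ht]. apply Ht. unfold I01; lra.
Qed.

Lemma Cauchy_mean_value01 (f g f' g' : R -> R) (a b : R) :
  (forall x, I01 x -> continuous01 f x) -> (forall x, I01 x -> continuous01 g x) ->
  (forall x, 0 < x < 1 -> is_derive f x (f' x)) ->
  (forall x, 0 < x < 1 -> is_derive g x (g' x)) ->
  0 <= a -> a < b -> b <= 1 ->
  exists c, a < c < b /\ (g b - g a) * f' c = (f b - f a) * g' c.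
Proof.
intros Hf Hg Df Dg Ha Hab Hb.
assert (Dc : forall (w w' : R -> R), (forall x, 0 < x < 1 -> is_derive w x (w' x)) ->
  forall c, a < c < b -> derivable_pt_lim (fun t => w (clamp t)) c (w' c)).
{ intros w w' Dw c Hc. apply is_derive_Reals.
  apply is_derive_ext_loc with w; [|apply Dw; lra].
  generalize (locally_interior c ltac:(lra)). apply filter_imp.
  intros t Ht. rewrite clamp_id; [reflexivity|unfold I01; lra]. }
destruct (MVT (fun t => f (clamp t)) (fun t => g (clamp t)) a b
  (fun c Hc => exist _ (f' c) (Dc f f' Df c Hc)) (fun c Hc => exist _ (g' c) (Dc g g' Dg c Hc)) Hab)
  as (c & Hc & E).
- intros c _. apply continuous01_clamp; exact Hf.
- intros c _. apply continuous01_clamp; exact Hg.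
- exists c; split; [exact Hc|]. simpl in E. rewrite !clamp_id in E by (unfold I01; lra).
  exact E.
Qed.

Lemma mean_value01 (f f' : R -> R) (a b : R) :
  (forall x, I01 x -> continuous01 f x) ->
  (forall x, 0 < x < 1 -> is_derive f x (f' x)) ->
  0 <= a -> a < b -> b <= 1 ->
  exists c, a < c < b /\ f b - f a = f' c * (b - a).
Proof.
intros Hf Df Ha Hab Hb.
destruct (Cauchy_mean_value01 f (fun t => t) f' (fun _ => 1) a b) as (c & Hc & E); auto.
- intros x Hx. apply continuous01_eps. intros eps He. exists eps; auto.
- intros x _. apply @is_derive_id.
- exists c; split; [exact Hc|]. lra.
Qed.

(** Caratheodory's form of differentiability: completed by the derivative [l],
    the difference quotient is continuous at [x]. *)
Definition slope (f : R -> R) (x l t : R) : R :=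
  if Req_EM_T t x then l else (f t - f x) / (t - x).

Lemma slope_mult (f : R -> R) (x l t : R) : f t - f x = slope f x l t * (t - x).
Proof.
unfold slope. destruct (Req_EM_T t x) as [->|N]; [ring|field; lra].
Qed.

Lemma slope_continuous (f : R -> R) (x l : R) :
  is_derive f x l -> continuity_pt (slope f x l) x.
Proof.
intros H. apply is_derive_Reals in H. apply continuity_pt_eps. intros eps He.
destruct (H eps He) as [d Hd]. exists d; split; [apply cond_pos|].
intros t Ht. unfold slope.
destruct (Req_EM_T x x) as [_|N]; [|contradiction].
destruct (Req_EM_T t x) as [->|N].
- rewrite Rminus_eq_0, Rabs_R0; exact He.
- specialize (Hd (t - x) ltac:(lra) Ht). replace (x + (t - x)) with t in Hd by ring. exact Hd.
Qed.

Lemma implicit_derive (H u g : R -> R) (x h' g' : R) :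
  locally x (fun t => H (u t) = g t) -> continuity_pt u x ->
  is_derive H (u x) h' -> h' <> 0 -> is_derive g x g' -> is_derive u x (g' / h').
Proof.
intros E Hu DH Hh Dg.
assert (Ex : H (u x) = g x) by exact (locally_singleton _ _ E).
set (q := fun t => slope H (u x) h' (u t)).
assert (Hqx : q x = h').
{ unfold q, slope. destruct (Req_EM_T (u x) (u x)); [reflexivity|contradiction]. }
assert (Hq : continuity_pt q x).
{ apply (continuity_pt_comp u (slope H (u x) h')); [exact Hu|apply slope_continuous, DH]. }
assert (Hr := slope_continuous g x g' Dg).
assert (Hrx : slope g x g' x = g').
{ unfold slope. destruct (Req_EM_T x x); [reflexivity|contradiction]. }
assert (Hd : continuity_pt (fun t => slope g x g' t / q t) x).
{ apply (continuity_pt_div (slope g x g') q); auto. rewrite Hqx; exact Hh. }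
apply is_derive_Reals. intros eps He.
destruct (proj1 (continuity_pt_eps _ x) Hd eps He) as (d1 & Hd1 & H1).
destruct (proj1 (continuity_pt_eps _ x) Hq (Rabs h') (Rabs_pos_lt _ Hh)) as (d2 & Hd2 & H2).
destruct E as [d3 H3]. pose proof (cond_pos d3).
assert (Hp : 0 < Rmin d1 (Rmin d2 d3)) by (repeat apply Rmin_glb_lt; lra).
exists (mkposreal _ Hp). simpl. intros s Hs Bs.
pose proof (Rmin_l d1 (Rmin d2 d3)). pose proof (Rmin_r d1 (Rmin d2 d3)).
pose proof (Rmin_l d2 d3). pose proof (Rmin_r d2 d3).
assert (Es : Rabs (x + s - x) = Rabs s) by (f_equal; ring).
specialize (H1 (x + s)). rewrite Es in H1. specialize (H1 ltac:(lra)).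
specialize (H2 (x + s)). rewrite Es in H2. specialize (H2 ltac:(lra)).
assert (Hqs : q (x + s) <> 0).
{ intros Z. rewrite Z, Hqx, Rminus_0_l, Rabs_Ropp in H2. lra. }
assert (B3 : ball x d3 (x + s)) by (change (Rabs (x + s - x) < d3); rewrite Es; lra).
specialize (H3 _ B3). rewrite Hrx, Hqx in H1.
replace ((u (x + s) - u x) / s) with (slope g x g' (x + s) / q (x + s)); [exact H1|].
pose proof (slope_mult g x g' (x + s)) as S1.
pose proof (slope_mult H (u x) h' (u (x + s))) as S2. fold (q (x + s)) in S2.
rewrite H3, Ex, S1 in S2. replace (x + s - x) with s in S2 by ring.
apply (Rmult_eq_reg_r (s * q (x + s))); [|apply Rmult_integral_contrapositive; auto].
replace (slope g x g' (x + s) / q (x + s) * (s * q (x + s)))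
  with (slope g x g' (x + s) * s) by (field; auto).
rewrite S2. field; auto.
Qed.

Lemma implicit_continuous01 (H u g : R -> R) (lo hi : R) :
  (forall v w, lo <= v -> v < w -> w <= hi -> H v < H w) ->
  (forall x, I01 x -> lo <= u x <= hi /\ H (u x) = g x) ->
  (forall x, I01 x -> continuous01 g x) ->
  forall x, I01 x -> continuous01 u x.
Proof.
intros Hinc Hu Hg x Ix. apply continuous01_eps. intros eps He.
assert (Hle : forall v w, lo <= v <= hi -> lo <= w <= hi -> H v < H w -> v < w).
{ intros v w Iv Iw L. destruct (Rtotal_order v w) as [|[->|G]]; [assumption|lra|].
  specialize (Hinc w v ltac:(lra) G ltac:(lra)). lra. }
destruct (Hu x Ix) as [Bx Ex].
assert (Up : exists d, 0 < d /\ forall y, I01 y -> Rabs (y - x) < d -> u y < u x + eps).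
{ destruct (Rle_dec (u x + eps) hi) as [L|N].
  - pose proof (Hinc (u x) (u x + eps) ltac:(lra) ltac:(lra) L) as I.
    destruct (proj1 (continuous01_eps g x) (Hg x Ix) (H (u x + eps) - H (u x)) ltac:(lra))
      as (d & Hd & Hy).
    exists d; split; [exact Hd|]. intros y Iy B. specialize (Hy y Iy B).
    apply Rabs_lt_between in Hy. destruct (Hu y Iy) as [By Ey].
    apply Hle; lra.
  - exists 1; split; [lra|]. intros y Iy _. destruct (Hu y Iy); lra. }
assert (Lo : exists d, 0 < d /\ forall y, I01 y -> Rabs (y - x) < d -> u x - eps < u y).
{ destruct (Rle_dec lo (u x - eps)) as [L|N].
  - pose proof (Hinc (u x - eps) (u x) L ltac:(lra) ltac:(lra)) as I.
    destruct (proj1 (continuous01_eps g x) (Hg x Ix) (H (u x) - H (u x - eps)) ltac:(lra))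
      as (d & Hd & Hy).
    exists d; split; [exact Hd|]. intros y Iy B. specialize (Hy y Iy B).
    apply Rabs_lt_between in Hy. destruct (Hu y Iy) as [By Ey].
    apply Hle; lra.
  - exists 1; split; [lra|]. intros y Iy _. destruct (Hu y Iy); lra. }
destruct Up as (d1 & Hd1 & H1). destruct Lo as (d2 & Hd2 & H2).
exists (Rmin d1 d2); split; [apply Rmin_glb_lt; lra|]. intros y Iy B.
pose proof (Rmin_l d1 d2). pose proof (Rmin_r d1 d2).
specialize (H1 y Iy ltac:(lra)). specialize (H2 y Iy ltac:(lra)).
apply Rabs_lt_between; lra.
Qed.

(** * The profile of the cylinder *)

Lemma Derive01_correct (f : R -> R) (x : R) :
  I01 x -> ex_derive01 f x -> is_derive01 f x (Derive01 f x).
Proof.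
intros Hx [l Hl]. rewrite (is_derive01_unique f x l Hx Hl). exact Hl.
Qed.

Record profile (n n1 n2 : R -> R) : Prop := {
  pr_n1 : forall x, I01 x -> is_derive01 n x (n1 x);
  pr_n2 : forall x, I01 x -> is_derive01 n1 x (n2 x);
  pr_n2_cont : forall x, I01 x -> continuous01 n2 x;
  pr_pos : forall x, I01 x -> 0 < n x;
  pr_convex : 0 < n2 1;
  pr_decr : forall x, 0 < x < 1 -> n1 x < 0;
  pr_n1_exit : n1 1 = 0;
  pr_n_exit : n 1 = 1
}.

Lemma admissible_profile_profile (n : R -> R) :
  admissible_profile n -> profile n (Derive01 n) (Derive01 (Derive01 n)).
Proof.
intros (Hpos & Hs & Hc & Hd & H1 & H2). split; auto.
- intros x Hx. apply Derive01_correct; [exact Hx|exact (Hs 0%nat x Hx)].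
- intros x Hx. apply Derive01_correct; [exact Hx|exact (Hs 1%nat x Hx)].
- intros x Hx. eapply is_derive01_continuous01; [exact Hx|].
  apply Derive01_correct; [exact Hx|exact (Hs 2%nat x Hx)].
- apply Hc. unfold I01; lra.
Qed.

Lemma profile_continuous (n n1 n2 : R -> R) (x : R) :
  profile n n1 n2 -> I01 x -> continuous01 n x.
Proof. intros Hn Hx. eapply is_derive01_continuous01; [|apply (pr_n1 _ _ _ Hn)]; exact Hx. Qed.

Lemma profile_continuous1 (n n1 n2 : R -> R) (x : R) :
  profile n n1 n2 -> I01 x -> continuous01 n1 x.
Proof. intros Hn Hx. eapply is_derive01_continuous01; [|apply (pr_n2 _ _ _ Hn)]; exact Hx. Qed.

Lemma profile_derive (n n1 n2 : R -> R) (x : R) :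
  profile n n1 n2 -> 0 < x < 1 -> is_derive n x (n1 x).
Proof.
intros Hn Hx. apply is_derive01_is_derive; [exact Hx|]. apply (pr_n1 _ _ _ Hn). unfold I01; lra.
Qed.

Lemma profile_derive1 (n n1 n2 : R -> R) (x : R) :
  profile n n1 n2 -> 0 < x < 1 -> is_derive n1 x (n2 x).
Proof.
intros Hn Hx. apply is_derive01_is_derive; [exact Hx|]. apply (pr_n2 _ _ _ Hn). unfold I01; lra.
Qed.

Lemma profile_decreasing (n n1 n2 : R -> R) (a b : R) :
  profile n n1 n2 -> 0 <= a -> a < b -> b <= 1 -> n b < n a.
Proof.
intros Hn Ha Hab Hb.
destruct (mean_value01 n n1 a b (fun x => profile_continuous n n1 n2 x Hn)
  (fun x => profile_derive n n1 n2 x Hn) Ha Hab Hb) as (c & Hc & E).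
pose proof (pr_decr _ _ _ Hn c ltac:(lra)). nra.
Qed.

(** * Existence of the symmetric flow *)

(** Up to a constant, [gas_H] is [gamma - 1] times the logarithm of the mass
    flux density at speed [v]. *)
Definition gas_H (gamma c0 v : R) : R :=
  (gamma - 1) * ln v + ln (c0 - (gamma - 1) / 2 * v ^ 2).

Lemma is_b1_c0 (gamma c0 b1 : R) :
  1 < gamma -> is_b1 gamma c0 b1 -> c0 = (gamma + 1) / 2 * b1 ^ 2.
Proof. intros Hg [_ ->]. field. lra. Qed.

Lemma sound2_minus_speed2 (gamma c0 b1 v : R) :
  1 < gamma -> is_b1 gamma c0 b1 ->
  c0 - (gamma - 1) / 2 * v ^ 2 - v ^ 2 = (gamma + 1) / 2 * (b1 ^ 2 - v ^ 2).
Proof. intros Hg Hb1. rewrite (is_b1_c0 gamma c0 b1 Hg Hb1). field. Qed.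

Lemma sound2_pos (gamma c0 b1 v : R) :
  1 < gamma -> is_b1 gamma c0 b1 -> 0 <= v <= b1 -> 0 < c0 - (gamma - 1) / 2 * v ^ 2.
Proof.
intros Hg Hb1 Hv. pose proof (sound2_minus_speed2 gamma c0 b1 v Hg Hb1). pose proof (proj1 Hb1) as Hp.
assert (v ^ 2 <= b1 ^ 2) by (apply pow_incr; lra).
destruct (Req_dec v 0) as [->|N].
- pose proof (is_b1_c0 gamma c0 b1 Hg Hb1). assert (0 < b1 ^ 2) by (apply pow_lt; lra). nra.
- assert (0 < v ^ 2) by (apply pow_lt; lra). nra.
Qed.

Lemma gas_H_derive (gamma c0 b1 v : R) :
  1 < gamma -> is_b1 gamma c0 b1 ->
  0 < v <= b1 ->
  is_derive (gas_H gamma c0) v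
    ((gamma ^ 2 - 1) / 2 * (b1 ^ 2 - v ^ 2) / (v * (c0 - (gamma - 1) / 2 * v ^ 2))).
Proof.
intros Hg Hb1 Hv. pose proof (sound2_pos gamma c0 b1 v Hg Hb1 ltac:(lra)) as Hc.
assert (E : c0 + - ((gamma - 1) / 2 * (v * (v * 1))) = c0 - (gamma - 1) / 2 * v ^ 2) by ring.
unfold gas_H. auto_derive.
- rewrite E. repeat split; [lra|exact Hc].
- rewrite E.
  replace ((gamma ^ 2 - 1) / 2 * (b1 ^ 2 - v ^ 2))
    with ((gamma - 1) * ((gamma + 1) / 2 * (b1 ^ 2 - v ^ 2))) by field.
  rewrite <- (sound2_minus_speed2 gamma c0 b1 v Hg Hb1). field. lra.
Qed.

Lemma gas_H_increasing (gamma c0 b1 v w : R) :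
  1 < gamma -> is_b1 gamma c0 b1 -> 0 < v -> v < w -> w <= b1 -> gas_H gamma c0 v < gas_H gamma c0 w.
Proof.
intros Hg Hb1 Hv Hvw Hw.
destruct (MVT_cor2 (gas_H gamma c0)
  (fun v => (gamma ^ 2 - 1) / 2 * (b1 ^ 2 - v ^ 2) / (v * (c0 - (gamma - 1) / 2 * v ^ 2))) v w Hvw)
  as (c & E & Hc).
- intros c Hc. apply is_derive_Reals, gas_H_derive; auto. lra.
- assert (0 < (gamma ^ 2 - 1) / 2 * (b1 ^ 2 - c ^ 2) / (c * (c0 - (gamma - 1) / 2 * c ^ 2))).
  { apply Rdiv_lt_0_compat.
    - apply Rmult_lt_0_compat; nra.
    - apply Rmult_lt_0_compat; [lra|]. apply (sound2_pos gamma c0 b1); auto; lra. }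
  nra.
Qed.

Lemma gas_H_sonic (gamma c0 b1 : R) :
  1 < gamma -> is_b1 gamma c0 b1 -> gas_H gamma c0 b1 = (gamma + 1) * ln b1.
Proof.
intros Hg Hb1. unfold gas_H. pose proof (proj1 Hb1) as Hp.
replace (c0 - (gamma - 1) / 2 * b1 ^ 2) with (b1 * b1).
- rewrite ln_mult by lra. ring.
- pose proof (sound2_minus_speed2 gamma c0 b1 b1 Hg Hb1) as E.
  replace (b1 ^ 2 - b1 ^ 2) with 0 in E by ring. lra.
Qed.

Lemma gas_H_entry (gamma c0 b1 b0 : R) (n : R -> R) :
  1 < gamma -> is_b1 gamma c0 b1 -> is_b0 gamma c0 n b1 b0 ->
  gas_H gamma c0 b0 = (gamma + 1) * ln b1 - (gamma - 1) * ln (n 0).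
Proof.
intros Hg Hb1 [Hb0 E]. pose proof (sound2_pos gamma c0 b1 b0 Hg Hb1 ltac:(lra)) as Hc.
apply (f_equal ln) in E. unfold Rpower in E.
rewrite 2 ln_mult in E; [|apply exp_pos|exact Hc|apply Rmult_lt_0_compat; [apply exp_pos|exact Hc]|apply exp_pos].
rewrite !ln_exp in E. unfold gas_H. lra.
Qed.

Lemma ln_derive (n : R -> R) (x l : R) :
  is_derive n x l -> 0 < n x -> is_derive (fun t => ln (n t)) x (l / n x).
Proof.
intros D Hp. replace (l / n x) with (scal l (/ n x)) by reflexivity.
apply (is_derive_comp ln n); [|exact D]. apply is_derive_Reals, derivable_pt_lim_ln, Hp.
Qed.

(** Bernoulli's law solved for the density. *)
Definition gas_density (gamma c0 v : R) : R :=
  Rpower ((c0 - (gamma - 1) / 2 * v ^ 2) / gamma) (1 / (gamma - 1)).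

Lemma gas_density_sound (gamma c0 b1 v : R) :
  1 < gamma -> is_b1 gamma c0 b1 -> 0 <= v <= b1 ->
  gamma * Rpower (gas_density gamma c0 v) (gamma - 1) = c0 - (gamma - 1) / 2 * v ^ 2.
Proof.
intros Hg Hb1 Hv. pose proof (sound2_pos gamma c0 b1 v Hg Hb1 Hv) as Hc.
unfold gas_density. rewrite Rpower_mult.
replace (1 / (gamma - 1) * (gamma - 1)) with 1 by (field; lra).
rewrite Rpower_1; [field; lra|apply Rdiv_lt_0_compat; lra].
Qed.

Lemma gas_density_derive (gamma c0 b1 v : R) :
  1 < gamma -> is_b1 gamma c0 b1 -> 0 <= v <= b1 -> ex_derive (gas_density gamma c0) v.
Proof.
intros Hg Hb1 Hv. pose proof (sound2_pos gamma c0 b1 v Hg Hb1 Hv) as Hc.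
assert (E : c0 + - ((gamma - 1) / 2 * (v * (v * 1))) = c0 - (gamma - 1) / 2 * v ^ 2) by ring.
unfold gas_density, Rpower. auto_derive. unfold Rdiv, Rminus in *. rewrite E.
apply (Rdiv_lt_0_compat _ gamma Hc). lra.
Qed.

Lemma gas_flux (gamma c0 b1 m v : R) :
  1 < gamma -> is_b1 gamma c0 b1 -> 0 < v <= b1 -> 0 < m ->
  m * gas_density gamma c0 v * v =
    exp ((gas_H gamma c0 v + (gamma - 1) * ln m - ln gamma) / (gamma - 1)).
Proof.
intros Hg Hb1 Hv Hm. pose proof (sound2_pos gamma c0 b1 v Hg Hb1 ltac:(lra)) as Hc.
unfold gas_density, Rpower, gas_H. rewrite ln_div by lra.
rewrite <- (exp_ln m) at 1 by exact Hm. rewrite <- (exp_ln v) at 2 by lra.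
rewrite <- !exp_plus. f_equal. field. lra.
Qed.

(** Constant mass flux means that [gas_H (u x) + (gamma - 1) ln (n x)] is constant,
    and [gas_H] is invertible between [b0] and [b1], where the flow is subsonic.
    As [n] decreases, the flow accelerates. *)
Lemma symmetric_flow_exists (gamma c0 b0 b1 : R) (n n1 n2 : R -> R) :
  1 < gamma -> is_b1 gamma c0 b1 -> profile n n1 n2 -> is_b0 gamma c0 n b1 b0 ->
  exists u rho, symmetric_flow gamma c0 n b0 b1 u rho.
Proof.
intros Hg Hb1 Hn Hb0.
pose proof (gas_H_sonic gamma c0 b1 Hg Hb1) as Hson.
pose proof (gas_H_entry gamma c0 b1 b0 n Hg Hb1 Hb0) as Hent.
destruct Hb0 as [Hb01 _].
assert (Hinc : forall v w, b0 <= v -> v < w -> w <= b1 -> gas_H gamma c0 v < gas_H gamma c0 w).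
{ intros v w Hv Hvw Hw. apply (gas_H_increasing gamma c0 b1); auto; lra. }
set (g := fun x => (gamma + 1) * ln b1 - (gamma - 1) * ln (n x)).
assert (Hn1 : forall x, I01 x -> 1 <= n x <= n 0).
{ intros x [H0 H1]. pose proof (pr_n_exit _ _ _ Hn) as E. split.
  - destruct (Req_dec x 1) as [->|]; [lra|]. rewrite <- E. left.
    apply (profile_decreasing n n1 n2 x 1 Hn); lra.
  - destruct (Req_dec x 0) as [->|]; [lra|]. left.
    apply (profile_decreasing n n1 n2 0 x Hn); lra. }
assert (Hgr : forall x, I01 x -> gas_H gamma c0 b0 <= g x <= gas_H gamma c0 b1).
{ intros x Hx. rewrite Hent, Hson. unfold g. destruct (Hn1 x Hx) as [L U].
  assert (0 <= ln (n x)) by (rewrite <- ln_1; apply ln_le; lra).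
  assert (ln (n x) <= ln (n 0)) by (apply ln_le; lra).
  split; nra. }
assert (Hex : forall x, exists v, I01 x -> b0 <= v <= b1 /\ gas_H gamma c0 v = g x).
{ intros x. destruct (classic (I01 x)) as [Ix|N]; [|exists 0; contradiction].
  destruct (f_interv_is_interv (gas_H gamma c0) b0 b1 (g x)) as (v & Iv & Ev); [lra| | |].
  - apply Hgr, Ix.
  - intros v Hv. eapply is_derive_continuity_pt. apply (gas_H_derive gamma c0 b1); auto. lra.
  - exists v; intros _; split; assumption. }
destruct (functional_choice _ Hex) as [u Hu]. clear Hex.
assert (Hgc : forall x, I01 x -> continuous01 g x).
{ intros x Hx. pose proof (Hn1 x Hx).
  apply (continuous01_comp (fun m => (gamma + 1) * ln b1 - (gamma - 1) * ln m) n).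
  - apply (profile_continuous n n1 n2); auto.
  - apply (is_derive_continuity_pt _ _ (- (gamma - 1) / n x)). auto_derive; [lra|field; lra]. }
assert (Huc : forall x, I01 x -> continuous01 u x).
{ apply (implicit_continuous01 (gas_H gamma c0) u g b0 b1); auto. }
assert (I0 : I01 0) by (unfold I01; lra). assert (I1 : I01 1) by (unfold I01; lra).
assert (Hinj : forall v w, b0 <= v <= b1 -> b0 <= w <= b1 ->
  gas_H gamma c0 v = gas_H gamma c0 w -> v = w).
{ intros v w Hv Hw E. destruct (Rtotal_order v w) as [L|[|L]]; [|assumption|];
  apply Hinc in L; lra. }
assert (U0 : u 0 = b0).
{ destruct (Hu 0 I0) as [B E]. apply Hinj; try lra. rewrite E, Hent. reflexivity. }
assert (U1 : u 1 = b1).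
{ destruct (Hu 1 I1) as [B E]. apply Hinj; try lra. rewrite E, Hson. unfold g.
  rewrite (pr_n_exit _ _ _ Hn), ln_1. ring. }
assert (Ult : forall x, 0 <= x < 1 -> u x < b1).
{ intros x Hx. assert (Ix : I01 x) by (unfold I01; lra). destruct (Hu x Ix) as [B E].
  destruct (Req_dec (u x) b1) as [Eb|]; [exfalso|lra].
  rewrite Eb, Hson in E. unfold g in E.
  assert (0 < ln (n x)).
  { rewrite <- ln_1. apply ln_increasing; [lra|]. rewrite <- (pr_n_exit _ _ _ Hn).
    apply (profile_decreasing n n1 n2 x 1 Hn); lra. }
  nra. }
assert (Dg : forall x, 0 < x < 1 -> is_derive g x (- (gamma - 1) * n1 x / n x)).
{ intros x Hx. pose proof (pr_pos _ _ _ Hn x ltac:(unfold I01; lra)) as Hp. unfold g.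
  pose proof (ln_derive n x _ (profile_derive n n1 n2 x Hn Hx) Hp) as D.
  apply is_derive_ext with (fun t => minus ((gamma + 1) * ln b1) (scal (gamma - 1) (ln (n t))));
    [intros; reflexivity|].
  replace (- (gamma - 1) * n1 x / n x) with (minus 0 (scal (gamma - 1) (n1 x / n x)))
    by (unfold minus, plus, opp, scal; simpl; unfold mult; simpl; field; lra).
  apply @is_derive_minus; [apply @is_derive_const|]. apply is_derive_scal, D. }
assert (Du : forall x, 0 < x < 1 -> exists l, is_derive u x l /\ 0 < l).
{ intros x Hx. assert (Ix : I01 x) by (unfold I01; lra). destruct (Hu x Ix) as [B E].
  specialize (Ult x ltac:(lra)).
  pose proof (gas_H_derive gamma c0 b1 (u x) Hg Hb1 ltac:(lra)) as DH.
  assert (Hh : 0 < (gamma ^ 2 - 1) / 2 * (b1 ^ 2 - u x ^ 2)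
    / (u x * (c0 - (gamma - 1) / 2 * u x ^ 2))).
  { apply Rdiv_lt_0_compat.
    - apply Rmult_lt_0_compat; nra.
    - apply Rmult_lt_0_compat; [lra|]. apply (sound2_pos gamma c0 b1); auto; lra. }
  assert (HE : locally x (fun t => gas_H gamma c0 (u t) = g t)).
  { generalize (locally_interior x Hx). apply filter_imp. intros t Ht.
    apply Hu. unfold I01; lra. }
  pose proof (implicit_derive (gas_H gamma c0) u g x _ _ HE
    (continuous01_interior u x Hx (Huc x Ix)) DH (Rgt_not_eq _ _ Hh) (Dg x Hx)) as D.
  eexists; split; [exact D|].
  apply Rdiv_lt_0_compat; [|exact Hh].
  pose proof (pr_pos _ _ _ Hn x Ix). pose proof (pr_decr _ _ _ Hn x Hx).
  apply Rdiv_lt_0_compat; nra. }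
exists u, (fun x => gas_density gamma c0 (u x)).
assert (Hflux : forall x, I01 x -> n x * gas_density gamma c0 (u x) * u x =
  exp (((gamma + 1) * ln b1 - ln gamma) / (gamma - 1))).
{ intros x Hx. destruct (Hu x Hx) as [B E].
  rewrite (gas_flux gamma c0 b1); auto; [|lra|apply (pr_pos _ _ _ Hn); exact Hx].
  f_equal. rewrite E. unfold g. field. lra. }
assert (Hsound : forall x, I01 x -> gamma * Rpower (gas_density gamma c0 (u x)) (gamma - 1)
  = c0 - (gamma - 1) / 2 * u x ^ 2).
{ intros x Hx. destruct (Hu x Hx) as [B _]. apply (gas_density_sound gamma c0 b1); auto. lra. }
assert (Hrc : forall x, I01 x -> ex_derive (gas_density gamma c0) (u x)).
{ intros x Hx. destruct (Hu x Hx) as [B _]. apply (gas_density_derive gamma c0 b1); auto. lra. }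
split; [|split; [|split; [|split; [|split; [|split; [|split; [|split; [|split]]]]]]]].
- intros x Hx. split; [apply Huc; exact Hx|].
  apply (continuous01_comp (gas_density gamma c0) u); [apply Huc; exact Hx|].
  destruct (Hrc x Hx) as [l Hl]. exact (is_derive_continuity_pt _ _ _ Hl).
- intros x Hx. destruct (Du x Hx) as (l & Dl & _). split; [exists l; exact Dl|].
  apply ex_derive_comp; [apply Hrc; unfold I01; lra|exists l; exact Dl].
- intros x _. apply exp_pos.
- intros x Hx.
  apply is_derive_ext_loc with (fun _ => exp (((gamma + 1) * ln b1 - ln gamma) / (gamma - 1)));
    [|apply @is_derive_const].
  generalize (locally_interior x Hx). apply filter_imp. intros t Ht.
  symmetry. apply Hflux. unfold I01; lra.
- intros x Hx. rewrite Hsound by exact Hx. field. lra.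
- exact U0.
- exact U1.
- intros x Hx. assert (Ix : I01 x) by (unfold I01; lra). rewrite Hsound by exact Ix.
  destruct (Hu x Ix) as [B _]. specialize (Ult x Hx). split; [apply pow_lt; lra|].
  pose proof (sound2_minus_speed2 gamma c0 b1 (u x) Hg Hb1) as E.
  assert (0 < (gamma + 1) / 2 * (b1 ^ 2 - u x ^ 2)) by (apply Rmult_lt_0_compat; nra). lra.
- rewrite Hsound by exact I1. rewrite U1.
  pose proof (sound2_minus_speed2 gamma c0 b1 b1 Hg Hb1) as E. lra.
- intros x Hx. destruct (Du x Hx) as (l & Dl & Hl).
  rewrite (is_derive_unique _ _ _ Dl). exact Hl.
Qed.

Lemma symmetric_solution_exists (gamma c0 b0 b1 : R) (n n1 n2 : R -> R) :
  1 < gamma -> is_b1 gamma c0 b1 -> profile n n1 n2 -> is_b0 gamma c0 n b1 b0 ->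
  exists phib, symmetric_solution gamma c0 n b0 b1 phib.
Proof.
intros Hg Hb1 Hn Hb0.
destruct (symmetric_flow_exists gamma c0 b0 b1 n n1 n2 Hg Hb1 Hn Hb0) as (u & rho & H).
exists (RInt (fun t => u (clamp t)) 0), u, rho. split; [exact H|].
intros x Hx. apply is_derive_is_derive01; [exact Hx|].
assert (Hc : forall t, continuity_pt (fun s => u (clamp s)) t).
{ apply continuous01_clamp. intros t Ht. apply H, Ht. }
replace (u x) with (u (clamp x)) by (rewrite clamp_id; [reflexivity|exact Hx]).
apply (is_derive_RInt (fun t => u (clamp t)) _ 0).
- exists (mkposreal 1 Rlt_0_1). intros t _. apply (RInt_correct (V := R_CompleteNormedModule)).
  apply (ex_RInt_continuous (V := R_CompleteNormedModule)).
  intros z _. apply continuity_pt_filterlim, Hc.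
- apply continuity_pt_filterlim, Hc.
Qed.

(** * Regularity of the symmetric flow up to the sonic circle *)

(** Differentiating Bernoulli's law and the constant mass flux eliminates the
    density. *)
Lemma symmetric_flow_ode (gamma c0 b0 b1 : R) (n n1 n2 u rho : R -> R) :
  1 < gamma -> profile n n1 n2 -> symmetric_flow gamma c0 n b0 b1 u rho ->
  forall x, 0 < x < 1 ->
    n x * (c0 - (gamma - 1) / 2 * u x ^ 2 - u x ^ 2) * Derive u x
    + n1 x * (c0 - (gamma - 1) / 2 * u x ^ 2) * u x = 0.
Proof.
intros Hg Hn (_ & Hd & Hr & Hflux & Hbern & _) x Hx.
assert (Ix : I01 x) by (unfold I01; lra).
destruct (Hd x Hx) as [[u' Du] [r' Dr]].
rewrite (is_derive_unique u x u' Du).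
pose proof (Hr x Ix) as Hrx.
pose proof (profile_derive n n1 n2 x Hn Hx) as Dn.
assert (E1 : n1 x * rho x * u x + n x * r' * u x + n x * rho x * u' = 0).
{ assert (D : is_derive (fun t => n t * rho t * u t) x
    (n1 x * rho x * u x + n x * r' * u x + n x * rho x * u')).
  { replace (n1 x * rho x * u x + n x * r' * u x + n x * rho x * u')
      with ((n1 x * rho x + n x * r') * u x + (n x * rho x) * u') by ring.
    apply (is_derive_mult (fun t => n t * rho t) u).
    - apply (is_derive_mult n rho); auto. intros; apply Rmult_comm.
    - exact Du.
    - intros; apply Rmult_comm. }
  apply is_derive_unique in D. rewrite <- D. apply is_derive_unique, Hflux, Hx. }
set (a := Rpower (rho x) (gamma - 1)).
assert (E2 : gamma * a * r' + rho x * (u x * u') = 0).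
{ assert (D : is_derive (fun t => gamma * Rpower (rho t) (gamma - 1) / (gamma - 1) + u t ^ 2 / 2)
    x (gamma * a * r' / rho x + u x * u')).
  { pose proof (ln_derive rho x r' Dr Hrx) as Dl.
    assert (De : is_derive (fun t => Rpower (rho t) (gamma - 1)) x ((gamma - 1) * (r' / rho x) * a)).
    { unfold Rpower. apply (is_derive_comp exp (fun t => (gamma - 1) * ln (rho t))).
      - apply is_derive_Reals, derivable_pt_lim_exp.
      - apply is_derive_scal, Dl. }
    replace (gamma * a * r' / rho x + u x * u')
      with (plus (scal (gamma / (gamma - 1)) ((gamma - 1) * (r' / rho x) * a))
        (scal (/ 2) (u' * u x + u x * u')))
      by (unfold plus, scal; simpl; unfold mult; simpl; field; lra).
    apply is_derive_ext with (fun t => plus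
      (scal (gamma / (gamma - 1)) (Rpower (rho t) (gamma - 1))) (scal (/ 2) (u t * u t)));
      [intros; unfold plus, scal; simpl; unfold mult; simpl; field; lra|].
    apply @is_derive_plus; apply is_derive_scal; [exact De|].
    apply (is_derive_mult u u); auto. intros; apply Rmult_comm. }
  assert (D0 : is_derive (fun t => gamma * Rpower (rho t) (gamma - 1) / (gamma - 1) + u t ^ 2 / 2)
    x 0).
  { apply is_derive_ext_loc with (fun _ => c0 / (gamma - 1)); [|apply @is_derive_const].
    generalize (locally_interior x Hx). apply filter_imp. intros t Ht.
    symmetry. apply Hbern. unfold I01; lra. }
  apply is_derive_unique in D. apply is_derive_unique in D0. rewrite D0 in D.
  replace (gamma * a * r' + rho x * (u x * u'))
    with (rho x * (gamma * a * r' / rho x + u x * u')) by (field; lra).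
  rewrite <- D. ring. }
assert (E3 : gamma * a = c0 - (gamma - 1) / 2 * u x ^ 2).
{ specialize (Hbern x Ix). fold a in Hbern.
  replace (gamma * a) with ((gamma * a / (gamma - 1)) * (gamma - 1)) by (field; lra).
  replace (gamma * a / (gamma - 1)) with (c0 / (gamma - 1) - u x ^ 2 / 2) by lra.
  field; lra. }
rewrite <- E3.
apply (Rmult_eq_reg_l (rho x)); [|lra]. rewrite Rmult_0_r.
replace (rho x * (n x * (gamma * a - u x ^ 2) * u' + n1 x * (gamma * a) * u x))
  with (gamma * a * (n1 x * rho x * u x + n x * r' * u x + n x * rho x * u')
        - n x * u x * (gamma * a * r' + rho x * (u x * u'))) by ring.
rewrite E1, E2. ring.
Qed.

Record symmetric_speed (gamma c0 b0 b1 : R) (n n1 u U : R -> R) : Prop := {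
  sy_entry : u 0 = b0;
  sy_exit : u 1 = b1;
  sy_pos : forall x, I01 x -> 0 < u x;
  sy_subsonic : forall x, 0 <= x < 1 -> u x < b1;
  sy_derive : forall x, I01 x -> is_derive01 u x (U x);
  sy_derive_cont : forall x, I01 x -> continuous01 U x;
  sy_ode : forall x, 0 < x < 1 ->
    n x * (c0 - (gamma - 1) / 2 * u x ^ 2 - u x ^ 2) * U x
    + n1 x * (c0 - (gamma - 1) / 2 * u x ^ 2) * u x = 0;
  sy_accelerating : 0 < U 1
}.

(** Near the sonic circle the equation for [u'] is of the form [0/0]. The squared
    defect [z = (b1^2 - u^2)^2] satisfies the regular equation
    [z' = 8/(gamma+1) c^2 u^2 n'/n], so that the quotient [n'^2 / z], to which
    [u'^2] is proportional, has a positive limit by Cauchy's mean value theorem. *)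
Lemma symmetric_speed_exists (gamma c0 b0 b1 : R) (n n1 n2 u rho : R -> R) :
  1 < gamma -> is_b1 gamma c0 b1 -> 0 < b0 -> profile n n1 n2 ->
  symmetric_flow gamma c0 n b0 b1 u rho ->
  exists U, symmetric_speed gamma c0 b0 b1 n n1 u U.
Proof.
intros Hg Hb1 Hb0 Hn Hs.
pose proof (symmetric_flow_ode gamma c0 b0 b1 n n1 n2 u rho Hg Hn Hs) as Hode.
destruct Hs as (Hc & Hd & _ & _ & _ & U0 & U1 & _ & _ & Hacc).
pose proof (proj1 Hb1) as Hb1p.
assert (Huc : forall x, I01 x -> continuous01 u x) by (intros x Hx; apply Hc, Hx).
assert (Du : forall x, 0 < x < 1 -> is_derive u x (Derive u x)).
{ intros x Hx. apply Derive_correct, Hd, Hx. }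
assert (Hinc : forall a b, 0 <= a -> a < b -> b <= 1 -> u a < u b).
{ intros a b Ha Hab Hb.
  destruct (mean_value01 u (Derive u) a b Huc Du Ha Hab Hb) as (c & Ic & E).
  specialize (Hacc c ltac:(lra)). nra. }
assert (Hpos : forall x, I01 x -> 0 < u x).
{ intros x [H0 H1]. destruct (Req_dec x 0) as [->|]; [lra|].
  specialize (Hinc 0 x ltac:(lra) ltac:(lra) H1). lra. }
assert (Hlt : forall x, 0 <= x < 1 -> u x < b1).
{ intros x Hx. rewrite <- U1. apply Hinc; lra. }
assert (Hle : forall x, I01 x -> u x <= b1).
{ intros x [H0 H1]. destruct (Req_dec x 1) as [->|]; [lra|]. left; apply Hlt; lra. }
assert (Hc2 : forall x, I01 x -> 0 < c0 - (gamma - 1) / 2 * u x ^ 2).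
{ intros x Hx. apply (sound2_pos gamma c0 b1); auto. specialize (Hpos x Hx).
  specialize (Hle x Hx). lra. }
set (c2 := fun x => c0 - (gamma - 1) / 2 * u x ^ 2).
set (F := fun x => - n1 x * c2 x * u x / (n x * ((gamma + 1) / 2 * (b1 ^ 2 - u x ^ 2)))).
assert (Hden : forall x, 0 <= x < 1 -> 0 < n x * ((gamma + 1) / 2 * (b1 ^ 2 - u x ^ 2))).
{ intros x Hx. pose proof (pr_pos _ _ _ Hn x ltac:(unfold I01; lra)).
  specialize (Hlt x Hx). specialize (Hpos x ltac:(unfold I01; lra)).
  apply Rmult_lt_0_compat; [lra|]. apply Rmult_lt_0_compat; nra. }
assert (HF : forall x, 0 < x < 1 -> Derive u x = F x).
{ intros x Hx. specialize (Hden x ltac:(lra)). specialize (Hode x Hx).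
  rewrite (sound2_minus_speed2 gamma c0 b1 (u x) Hg Hb1) in Hode.
  unfold F, c2. set (dn := n x * ((gamma + 1) / 2 * (b1 ^ 2 - u x ^ 2))) in *.
  apply (Rmult_eq_reg_r dn); [|lra].
  replace (- n1 x * (c0 - (gamma - 1) / 2 * u x ^ 2) * u x / dn * dn)
    with (- n1 x * (c0 - (gamma - 1) / 2 * u x ^ 2) * u x) by (field; lra). lra. }
assert (Cu := continuous01_clamp u Huc).
assert (Cn := continuous01_clamp n (fun x => profile_continuous n n1 n2 x Hn)).
assert (Cn1 := continuous01_clamp n1 (fun x => profile_continuous1 n n1 n2 x Hn)).
assert (Cn2 := continuous01_clamp n2 (pr_n2_cont _ _ _ Hn)).
assert (Cc2 : forall x, continuity_pt (fun t => c2 (clamp t)) x).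
{ intros x. unfold c2. apply (continuity_pt_comp (fun t => u (clamp t))
    (fun v => c0 - (gamma - 1) / 2 * v ^ 2)); [apply Cu|].
  eapply is_derive_continuity_pt. auto_derive; [trivial|reflexivity]. }
set (q := fun t => 8 / (gamma + 1) * c2 t * u t ^ 2 / n t).
set (K := fun t => 4 / (gamma + 1) ^ 2 * (c2 t * u t / n t) ^ 2).
set (Q := fun t => 2 * n2 t / q t).
assert (Hq : forall x, I01 x -> 0 < q x).
{ intros x Hx. specialize (Hc2 x Hx). specialize (Hpos x Hx).
  pose proof (pr_pos _ _ _ Hn x Hx). unfold q, c2. apply Rdiv_lt_0_compat; [|lra].
  apply Rmult_lt_0_compat; [|apply pow_lt; lra]. apply Rmult_lt_0_compat; [|lra].
  apply Rdiv_lt_0_compat; lra. }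
assert (Csq : forall f : R -> R, (forall x, continuity_pt (fun t => f (clamp t)) x) ->
  forall x, continuity_pt (fun t => f (clamp t) ^ 2) x).
{ intros f Cf x. apply (continuity_pt_comp (fun t => f (clamp t)) (fun v => v ^ 2)); [apply Cf|].
  eapply is_derive_continuity_pt. auto_derive; [trivial|reflexivity]. }
assert (Hn0 : forall x, n (clamp x) <> 0).
{ intros x. pose proof (pr_pos _ _ _ Hn _ (clamp_I01 x)). lra. }
assert (Cq : forall x, continuity_pt (fun t => q (clamp t)) x).
{ intros x. unfold q. apply (continuity_pt_div
    (fun t => 8 / (gamma + 1) * c2 (clamp t) * u (clamp t) ^ 2) (fun t => n (clamp t)));
    [|apply Cn|apply Hn0].
  apply (continuity_pt_mult (fun t => 8 / (gamma + 1) * c2 (clamp t)) (fun t => u (clamp t) ^ 2));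
    [|apply Csq, Cu].
  apply (continuity_pt_mult (fun _ => 8 / (gamma + 1)) (fun t => c2 (clamp t))); [|apply Cc2].
  apply continuity_pt_const; intros ? ?; reflexivity. }
assert (CK : forall x, continuity_pt (fun t => K (clamp t)) x).
{ intros x. unfold K.
  apply (continuity_pt_mult (fun _ => 4 / (gamma + 1) ^ 2)
    (fun t => (c2 (clamp t) * u (clamp t) / n (clamp t)) ^ 2));
    [apply continuity_pt_const; intros ? ?; reflexivity|].
  apply (Csq (fun t => c2 t * u t / n t)). intros t.
  apply (continuity_pt_div (fun t => c2 (clamp t) * u (clamp t)) (fun t => n (clamp t)));
    [|apply Cn|apply Hn0].
  apply (continuity_pt_mult (fun t => c2 (clamp t)) (fun t => u (clamp t))); [apply Cc2|apply Cu]. }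
assert (CQ : forall x, continuity_pt (fun t => Q (clamp t)) x).
{ intros x. unfold Q. apply (continuity_pt_div (fun t => 2 * n2 (clamp t)) (fun t => q (clamp t)));
    [|apply Cq|].
  - apply (continuity_pt_mult (fun _ => 2) (fun t => n2 (clamp t))); [|apply Cn2].
    apply continuity_pt_const; intros ? ?; reflexivity.
  - pose proof (Hq _ (clamp_I01 x)). lra. }
assert (I1 : I01 1) by (unfold I01; lra).
assert (HKQ : 0 < K 1 * Q 1).
{ pose proof (pr_convex _ _ _ Hn). pose proof (Hq 1 I1). unfold K, Q.
  pose proof (Hc2 1 I1). pose proof (Hpos 1 I1). pose proof (pr_pos _ _ _ Hn 1 I1).
  apply Rmult_lt_0_compat; [|apply Rdiv_lt_0_compat; lra].
  apply Rmult_lt_0_compat.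
  - apply Rdiv_lt_0_compat; [lra|apply pow_lt; lra].
  - apply pow_lt. unfold c2. apply Rdiv_lt_0_compat; [apply Rmult_lt_0_compat|]; lra. }
set (a := sqrt (K 1 * Q 1)).
assert (Ha : 0 < a) by (apply sqrt_lt_R0; exact HKQ).
assert (Ha2 : a * a = K 1 * Q 1) by (apply sqrt_sqrt; lra).
(* Cauchy's mean value theorem for [n'^2] and [z] between [x] and [1] *)
assert (Hsq : forall x, 0 < x < 1 -> exists xi, x < xi < 1 /\ F x * F x = K x * Q xi).
{ intros x Hx. assert (Ix : I01 x) by (unfold I01; lra).
  set (z := fun t => (b1 ^ 2 - u t ^ 2) ^ 2).
  destruct (Cauchy_mean_value01 (fun t => n1 t ^ 2) z (fun t => 2 * n1 t * n2 t)
    (fun t => q t * n1 t) x 1) as (xi & Hxi & E); try lra.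
  - intros t It. apply (continuous01_comp (fun v => v ^ 2) n1).
    + apply (profile_continuous1 n n1 n2); auto.
    + eapply is_derive_continuity_pt. auto_derive; [trivial|reflexivity].
  - intros t It. apply (continuous01_comp (fun v => (b1 ^ 2 - v ^ 2) ^ 2) u); [apply Huc, It|].
    eapply is_derive_continuity_pt. auto_derive; [trivial|reflexivity].
  - intros t It. pose proof (profile_derive1 n n1 n2 t Hn It) as D.
    replace (2 * n1 t * n2 t) with (scal (n2 t) (2 * n1 t)) by (unfold scal; simpl; unfold mult; simpl; ring).
    apply (is_derive_comp (fun v => v ^ 2) n1); [|exact D].
    auto_derive; [trivial|ring].
  - intros t It. pose proof (pr_pos _ _ _ Hn t ltac:(unfold I01; lra)).
    replace (q t * n1 t) with (scal (F t) (- 4 * u t * (b1 ^ 2 - u t ^ 2))).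
    + apply (is_derive_comp (fun v => (b1 ^ 2 - v ^ 2) ^ 2) u); [|rewrite <- HF by exact It; apply Du, It].
      auto_derive; [trivial|ring].
    + unfold scal; simpl; unfold mult; simpl. unfold q, F.
      assert (b1 ^ 2 - u t ^ 2 <> 0).
      { specialize (Hlt t ltac:(lra)). specialize (Hpos t ltac:(unfold I01; lra)). nra. }
      field. repeat split; lra.
  - exists xi; split; [exact Hxi|].
    rewrite (pr_n1_exit _ _ _ Hn) in E.
    assert (Ez : z 1 = 0) by (unfold z; rewrite U1; ring). rewrite Ez in E.
    pose proof (pr_decr _ _ _ Hn xi ltac:(lra)) as Hn1xi.
    pose proof (Hq xi ltac:(unfold I01; lra)) as Hqxi.
    pose proof (pr_pos _ _ _ Hn x Ix) as Hnx.
    assert (Hz : 0 < b1 ^ 2 - u x ^ 2).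
    { specialize (Hlt x ltac:(lra)). specialize (Hpos x Ix). nra. }
    assert (E' : n1 x ^ 2 * q xi = (b1 ^ 2 - u x ^ 2) ^ 2 * (2 * n2 xi)).
    { apply (Rmult_eq_reg_r (n1 xi)); [|lra]. fold (z x). lra. }
    assert (E'' : n1 x ^ 2 = (b1 ^ 2 - u x ^ 2) ^ 2 * Q xi).
    { unfold Q. apply (Rmult_eq_reg_r (q xi)); [|lra]. rewrite E'. field. lra. }
    replace (F x * F x) with
      (n1 x ^ 2 * (4 * (c2 x * u x) ^ 2 / (n x ^ 2 * (gamma + 1) ^ 2 * (b1 ^ 2 - u x ^ 2) ^ 2)))
      by (unfold F; field; lra).
    rewrite E''. unfold K. field. lra. }
set (U := fun x => if Rlt_dec x 1 then F x else a).
assert (HU : forall x, x < 1 -> U x = F x).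
{ intros x Hx. unfold U. destruct (Rlt_dec x 1); [reflexivity|contradiction]. }
assert (HU1 : U 1 = a).
{ unfold U. destruct (Rlt_dec 1 1); [lra|reflexivity]. }
assert (HFpos : forall x, 0 < x < 1 -> 0 < F x) by (intros x Hx; rewrite <- HF; auto).
assert (Uc : forall x, I01 x -> continuous01 U x).
{ intros x Hx. destruct (Rlt_dec x 1) as [L|N].
  - assert (CF : continuity_pt (fun t => F (clamp t)) x).
    { unfold F. apply (continuity_pt_div (fun t => - n1 (clamp t) * c2 (clamp t) * u (clamp t))
        (fun t => n (clamp t) * ((gamma + 1) / 2 * (b1 ^ 2 - u (clamp t) ^ 2)))).
      - apply (continuity_pt_mult (fun t => - n1 (clamp t) * c2 (clamp t)) (fun t => u (clamp t)));
          [|apply Cu].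
        apply (continuity_pt_mult (fun t => - n1 (clamp t)) (fun t => c2 (clamp t))); [|apply Cc2].
        apply (continuity_pt_opp (fun t => n1 (clamp t))), Cn1.
      - apply (continuity_pt_mult (fun t => n (clamp t))
          (fun t => (gamma + 1) / 2 * (b1 ^ 2 - u (clamp t) ^ 2))); [apply Cn|].
        apply (continuity_pt_comp (fun t => u (clamp t))
          (fun v => (gamma + 1) / 2 * (b1 ^ 2 - v ^ 2))); [apply Cu|].
        eapply is_derive_continuity_pt. auto_derive; [trivial|reflexivity].
      - rewrite clamp_id by exact Hx. unfold I01 in Hx. specialize (Hden x ltac:(lra)). lra. }
    apply continuous01_eps. intros eps He.
    destruct (proj1 (continuity_pt_eps _ x) CF eps He) as (d & Hdd & Hy).
    exists (Rmin d (1 - x)). split; [apply Rmin_glb_lt; lra|]. intros y Iy B.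
    pose proof (Rmin_l d (1 - x)). pose proof (Rmin_r d (1 - x)).
    specialize (Hy y ltac:(lra)). rewrite !clamp_id in Hy by auto.
    apply Rabs_lt_between in B. rewrite !HU by lra. exact Hy.
  - assert (x = 1) by (unfold I01 in Hx; lra). subst x. clear N.
    apply continuous01_eps. intros eps He.
    assert (CKQ : continuity_2d_pt (fun s t => K (clamp s) * Q (clamp t)) 1 1).
    { apply continuity_2d_pt_mult.
      - apply (continuity_1d_2d_pt_comp (fun t => K (clamp t)) (fun s _ => s));
          [apply CK|apply continuity_2d_pt_id1].
      - apply (continuity_1d_2d_pt_comp (fun t => Q (clamp t)) (fun _ t => t));
          [apply CQ|apply continuity_2d_pt_id2]. }
    assert (Hea : 0 < eps * a) by (apply Rmult_lt_0_compat; lra).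
    destruct (CKQ (mkposreal _ Hea)) as [d Hdy].
    pose proof (cond_pos d) as Hd0.
    exists (Rmin d 1). split; [apply Rmin_glb_lt; lra|]. intros y Iy B.
    pose proof (Rmin_l d 1). pose proof (Rmin_r d 1). rewrite HU1.
    destruct (Req_dec y 1) as [->|Ny]; [rewrite HU1, Rminus_eq_0, Rabs_R0; exact He|].
    apply Rabs_lt_between in B. unfold I01 in Iy. rewrite HU by lra.
    destruct (Hsq y ltac:(lra)) as (xi & Hxi & E).
    specialize (Hdy y xi ltac:(apply Rabs_lt_between; lra) ltac:(apply Rabs_lt_between; lra)).
    simpl in Hdy. rewrite !clamp_id in Hdy by (unfold I01; lra).
    rewrite <- E, <- Ha2 in Hdy.
    replace (F y * F y - a * a) with ((F y - a) * (F y + a)) in Hdy by ring.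
    specialize (HFpos y ltac:(lra)).
    rewrite Rabs_mult, (Rabs_pos_eq (F y + a)) in Hdy by lra.
    pose proof (Rabs_pos (F y - a)). nra. }
exists U. split; auto.
- apply is_derive01_of_interior; auto.
  intros x Hx. rewrite HU, <- HF by lra. apply Du, Hx.
- intros x Hx. rewrite HU, <- HF by lra. apply Hode, Hx.
- rewrite HU1. exact Ha.
Qed.

(** * Twice differentiable functions on the cylinder *)

Lemma continuity_2d_pt_div (f g : R -> R -> R) (x y : R) :
  continuity_2d_pt f x y -> continuity_2d_pt g x y -> g x y <> 0 ->
  continuity_2d_pt (fun s t => f s t / g s t) x y.
Proof.
intros Hf Hg Hz. apply continuity_2d_pt_mult; [exact Hf|].
apply continuity_2d_pt_inv; assumption.
Qed.

Lemma continuity_2d_pt_square (f : R -> R -> R) (x y : R) :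
  continuity_2d_pt f x y -> continuity_2d_pt (fun s t => f s t ^ 2) x y.
Proof.
intros Hf. apply (continuity_1d_2d_pt_comp (fun v => v ^ 2) f); [|exact Hf].
eapply is_derive_continuity_pt. auto_derive; [trivial|reflexivity].
Qed.

Ltac continuity_2d :=
  repeat first
    [ solve [auto]
    | apply continuity_2d_pt_const
    | apply continuity_2d_pt_plus
    | apply continuity_2d_pt_minus
    | apply continuity_2d_pt_opp
    | apply continuity_2d_pt_div
    | apply continuity_2d_pt_mult
    | apply continuity_2d_pt_square ].

Lemma Derive01_interior (f : R -> R) (x : R) :
  0 < x < 1 -> ex_derive01 f x -> Derive f x = Derive01 f x.
Proof.
intros Hx H. apply is_derive_unique, is_derive01_is_derive; [exact Hx|].
apply Derive01_correct; [unfold I01; lra|exact H].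
Qed.

Lemma Ckbar_D1 (k : nat) (f : R -> R -> R) (x y : R) :
  Ckbar (S k) f -> I01 x -> is_derive01 (fun t => f t y) x (D1 f x y).
Proof.
intros (_ & H & _) Hx. apply Derive01_correct; [exact Hx|]. apply H; exact Hx.
Qed.

Lemma Ckbar_D2 (k : nat) (f : R -> R -> R) (x y : R) :
  Ckbar (S k) f -> I01 x -> is_derive (f x) y (D2 f x y).
Proof.
intros (_ & H & _) Hx. apply Derive_correct. exact (proj2 (H x y Hx)).
Qed.

Lemma Ckbar_C0bar (k : nat) (f : R -> R -> R) : Ckbar k f -> C0bar f.
Proof. destruct k; [trivial|intros [H _]; exact H]. Qed.

(** Schwarz' theorem applies inside the cylinder, and both sides are continuous up
    to its boundary. *)
Lemma D1_D2_comm (f : R -> R -> R) (x y : R) :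
  Ckbar 2 f -> I01 x -> D1 (D2 f) x y = D2 (D1 f) x y.
Proof.
intros Hf Hx.
assert (H1 : Ckbar 1 (D1 f)) by apply Hf. assert (H2 : Ckbar 1 (D2 f)) by apply Hf.
assert (C12 := C0bar_clamp _ (Ckbar_C0bar 0 (D1 (D2 f)) (proj1 (proj2 (proj2 H2))))).
assert (C21 := C0bar_clamp _ (Ckbar_C0bar 0 (D2 (D1 f)) (proj2 (proj2 (proj2 H1))))).
assert (Hin : forall s, 0 < s < 1 -> locally_2d (fun a _ => 0 < a < 1) s y).
{ intros s Hs. destruct (locally_interior s Hs) as [d Hd].
  exists d. intros a b Ha _. apply Hd, Ha. }
assert (E : forall s t, 0 < s < 1 ->
  Derive (fun z => Derive (fun v => f z v) t) s = D1 (D2 f) s t /\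
  Derive (fun z => Derive (fun v => f v z) s) t = D2 (D1 f) s t).
{ intros s t Hs. assert (Is : I01 s) by (unfold I01; lra). split.
  - apply (Derive01_interior (fun z => D2 f z t)); [exact Hs|].
    exact (proj1 (proj1 (proj2 H2) s t Is)).
  - apply Derive_ext. intros z. apply Derive01_interior; [exact Hs|].
    exact (proj1 (proj1 (proj2 Hf) s z Is)). }
apply Rminus_diag_uniq.
rewrite <- (clamp_id x Hx).
apply (continuity_zero_closed (fun s => D1 (D2 f) (clamp s) y - D2 (D1 f) (clamp s) y)); [| |exact Hx].
- intros s. apply (continuity_2d_pt_fix_snd (fun s t => D1 (D2 f) (clamp s) t - D2 (D1 f) (clamp s) t)).
  apply continuity_2d_pt_minus; [apply C12|apply C21].
- intros s Hs. rewrite clamp_id by (unfold I01; lra). apply Rminus_diag_eq.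
  destruct (E s y Hs) as [<- <-]. apply Schwarz.
  + destruct (Hin s Hs) as [d Hd]. exists d. intros a b Ha Hb. specialize (Hd a b Ha Hb). simpl in Hd.
    assert (Ia : I01 a) by (unfold I01; lra).
    repeat split.
    * eexists. apply is_derive01_is_derive; [exact Hd|]. apply (Ckbar_D1 1); auto.
    * eexists. apply (Ckbar_D2 1); auto.
    * eexists. apply (is_derive01_is_derive (fun z => D2 f z b)); [exact Hd|]. apply (Ckbar_D1 0); auto.
    * apply (ex_derive_ext (D1 f a)).
      -- intros z. symmetry. apply Derive01_interior; [exact Hd|]. exact (proj1 (proj1 (proj2 Hf) a z Ia)).
      -- eexists. apply (Ckbar_D2 0); auto.
  + apply continuity_2d_pt_ext_loc with (fun a b => D1 (D2 f) (clamp a) b); [|apply C12].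
    destruct (Hin s Hs) as [d Hd]. exists d. intros a b Ha Hb. specialize (Hd a b Ha Hb). simpl in Hd.
    rewrite clamp_id by (unfold I01; lra). symmetry. apply E, Hd.
  + apply continuity_2d_pt_ext_loc with (fun a b => D2 (D1 f) (clamp a) b); [|apply C21].
    destruct (Hin s Hs) as [d Hd]. exists d. intros a b Ha Hb. specialize (Hd a b Ha Hb). simpl in Hd.
    rewrite clamp_id by (unfold I01; lra). symmetry. apply E, Hd.
Qed.

Lemma profile_continuity_2d (n n1 n2 : R -> R) :
  profile n n1 n2 ->
  (forall x y, continuity_2d_pt (fun s _ => n (clamp s)) x y) /\
  (forall x y, continuity_2d_pt (fun s _ => n1 (clamp s)) x y) /\
  (forall x y : R, n (clamp x) <> 0).
Proof.
intros Hn. repeat split.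
- intros x y. apply continuity_2d_pt_fst.
  apply (continuous01_clamp n (fun x => profile_continuous n n1 n2 x Hn)).
- intros x y. apply continuity_2d_pt_fst.
  apply (continuous01_clamp n1 (fun x => profile_continuous1 n n1 n2 x Hn)).
- intros x _. pose proof (pr_pos _ _ _ Hn _ (clamp_I01 x)). lra.
Qed.

(** * The flow is radial at the exit *)

(** At the sonic circle the equation, combined with the tangential derivative of
    the exit condition, reads [p2^2 phi11 + (b1^2 + p2^2) phi22 = 0]. Hence the
    tangential speed [p2] is nonincreasing along the circle; having a primitive
    on the circle, it vanishes. *)
Lemma exit_flow_radial (gamma c0 b1 : R) (n B : R -> R) (phi : R -> R -> R) :
  1 < gamma -> is_b1 gamma c0 b1 -> admissible_profile n ->
  C2_solution gamma c0 n b1 B phi ->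
  forall y, D1 phi 1 y = b1 /\ D2 phi 1 y = 0 /\ D2 (D2 phi) 1 y = 0.
Proof.
intros Hg Hb1 Hadm ((Hper & Hf) & Heq & Hexit & _ & (Hsign & Hsign2)).
pose proof (admissible_profile_profile n Hadm) as Hn.
assert (I1 : I01 1) by (unfold I01; lra).
assert (H1 : Ckbar 1 (D1 phi)) by apply Hf. assert (H2 : Ckbar 1 (D2 phi)) by apply Hf.
pose proof (proj1 Hb1) as Hb1p.
pose proof (sound2_minus_speed2 gamma c0 b1 b1 Hg Hb1) as Hson.
replace (b1 ^ 2 - b1 ^ 2) with 0 in Hson by ring.
assert (Esq : forall t, b1 ^ 2 = D1 phi 1 t * D1 phi 1 t + D2 phi 1 t * D2 phi 1 t).
{ intros t. rewrite <- (Hexit t). ring. }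
assert (Htan : forall y, D1 phi 1 y * D2 (D1 phi) 1 y + D2 phi 1 y * D2 (D2 phi) 1 y = 0).
{ intros y.
  assert (D : is_derive (fun t => D1 phi 1 t * D1 phi 1 t + D2 phi 1 t * D2 phi 1 t) y
    (plus (D2 (D1 phi) 1 y * D1 phi 1 y + D1 phi 1 y * D2 (D1 phi) 1 y)
      (D2 (D2 phi) 1 y * D2 phi 1 y + D2 phi 1 y * D2 (D2 phi) 1 y))).
  { apply @is_derive_plus.
    - apply (is_derive_mult (D1 phi 1) (D1 phi 1)); try (apply (Ckbar_D2 0); auto).
      intros; apply Rmult_comm.
    - apply (is_derive_mult (D2 phi 1) (D2 phi 1)); try (apply (Ckbar_D2 0); auto).
      intros; apply Rmult_comm. }
  assert (D0 : is_derive (fun t => D1 phi 1 t * D1 phi 1 t + D2 phi 1 t * D2 phi 1 t) y 0).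
  { apply is_derive_ext with (fun _ => b1 ^ 2); [|apply @is_derive_const].
    intros t. exact (Esq t). }
  apply is_derive_unique in D. apply is_derive_unique in D0. rewrite D0 in D.
  unfold plus in D; simpl in D. lra. }
assert (Heq1 : forall y, let c2 := sound2 gamma c0 n phi 1 y in
  (n 1) ^ 2 * (c2 - D1 phi 1 y ^ 2) * D1 (D1 phi) 1 y
  - 2 * D1 phi 1 y * D2 phi 1 y * D1 (D2 phi) 1 y
  + (c2 - D2 phi 1 y ^ 2 / (n 1) ^ 2) * D2 (D2 phi) 1 y
  + n 1 * Derive01 n 1 * (c2 + D2 phi 1 y ^ 2 / (n 1) ^ 2) * D1 phi 1 y = 0).
{ intros y. rewrite <- (clamp_id 1 I1).
  destruct (profile_continuity_2d _ _ _ Hn) as (Cn & Cn1 & Hn0).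
  assert (C1 := C0bar_clamp _ (Ckbar_C0bar 1 (D1 phi) H1)).
  assert (C2 := C0bar_clamp _ (Ckbar_C0bar 1 (D2 phi) H2)).
  assert (C11 := C0bar_clamp _ (Ckbar_C0bar 0 (D1 (D1 phi)) (proj1 (proj2 (proj2 H1))))).
  assert (C12 := C0bar_clamp _ (Ckbar_C0bar 0 (D1 (D2 phi)) (proj1 (proj2 (proj2 H2))))).
  assert (C22 := C0bar_clamp _ (Ckbar_C0bar 0 (D2 (D2 phi)) (proj2 (proj2 (proj2 H2))))).
  unfold sound2, speed2.
  apply (continuity_zero_closed (fun s =>
    (n (clamp s)) ^ 2 * ((gamma - 1) * (c0 / (gamma - 1) - (D1 phi (clamp s) y ^ 2
      + D2 phi (clamp s) y ^ 2 / n (clamp s) ^ 2) / 2) - D1 phi (clamp s) y ^ 2)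
      * D1 (D1 phi) (clamp s) y
    - 2 * D1 phi (clamp s) y * D2 phi (clamp s) y * D1 (D2 phi) (clamp s) y
    + ((gamma - 1) * (c0 / (gamma - 1) - (D1 phi (clamp s) y ^ 2
      + D2 phi (clamp s) y ^ 2 / n (clamp s) ^ 2) / 2)
      - D2 phi (clamp s) y ^ 2 / (n (clamp s)) ^ 2) * D2 (D2 phi) (clamp s) y
    + n (clamp s) * Derive01 n (clamp s) * ((gamma - 1) * (c0 / (gamma - 1)
      - (D1 phi (clamp s) y ^ 2 + D2 phi (clamp s) y ^ 2 / n (clamp s) ^ 2) / 2)
      + D2 phi (clamp s) y ^ 2 / (n (clamp s)) ^ 2) * D1 phi (clamp s) y)); [| |exact I1].
  - intros s. apply (continuity_2d_pt_fix_snd (fun s t =>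
      (n (clamp s)) ^ 2 * ((gamma - 1) * (c0 / (gamma - 1) - (D1 phi (clamp s) t ^ 2
        + D2 phi (clamp s) t ^ 2 / n (clamp s) ^ 2) / 2) - D1 phi (clamp s) t ^ 2)
        * D1 (D1 phi) (clamp s) t
      - 2 * D1 phi (clamp s) t * D2 phi (clamp s) t * D1 (D2 phi) (clamp s) t
      + ((gamma - 1) * (c0 / (gamma - 1) - (D1 phi (clamp s) t ^ 2
        + D2 phi (clamp s) t ^ 2 / n (clamp s) ^ 2) / 2)
        - D2 phi (clamp s) t ^ 2 / (n (clamp s)) ^ 2) * D2 (D2 phi) (clamp s) t
      + n (clamp s) * Derive01 n (clamp s) * ((gamma - 1) * (c0 / (gamma - 1)
        - (D1 phi (clamp s) t ^ 2 + D2 phi (clamp s) t ^ 2 / n (clamp s) ^ 2) / 2)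
        + D2 phi (clamp s) t ^ 2 / (n (clamp s)) ^ 2) * D1 phi (clamp s) t)).
    continuity_2d; try (apply pow_nonzero, Hn0; exact 0); lra.
  - intros s Hs. rewrite clamp_id by (unfold I01; lra). exact (Heq s y Hs). }
assert (Hkey : forall y, D2 phi 1 y ^ 2 * D1 (D1 phi) 1 y
  + (b1 ^ 2 + D2 phi 1 y ^ 2) * D2 (D2 phi) 1 y = 0).
{ intros y. specialize (Heq1 y). specialize (Htan y). specialize (Hexit y).
  assert (Ec : sound2 gamma c0 n phi 1 y = b1 ^ 2).
  { unfold sound2, speed2. rewrite (pr_n_exit _ _ _ Hn).
    replace (D1 phi 1 y ^ 2 + D2 phi 1 y ^ 2 / 1 ^ 2) with (b1 ^ 2) by (rewrite <- Hexit; field).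
    transitivity (c0 - (gamma - 1) / 2 * b1 ^ 2); [field; lra|lra]. }
  cbv zeta in Heq1.
  rewrite Ec, (D1_D2_comm phi 1 y Hf I1), (pr_n1_exit _ _ _ Hn), (pr_n_exit _ _ _ Hn), <- Hexit in Heq1.
  rewrite <- Hexit.
  set (p1 := D1 phi 1 y) in *. set (p2 := D2 phi 1 y) in *.
  transitivity (2 * p2 * (p1 * D2 (D1 phi) 1 y + p2 * D2 (D2 phi) 1 y)); [|rewrite Htan; ring].
  rewrite <- (Rplus_0_l (2 * p2 * _)), <- Heq1. field. }
assert (Hf22 : forall y, D2 (D2 phi) 1 y <= 0).
{ intros y. specialize (Hkey y). specialize (Hsign2 y).
  pose proof (pow2_ge_0 (D2 phi 1 y)). assert (0 < b1 ^ 2) by (apply pow_lt; lra). nra. }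
assert (Hmono : forall a b, a < b -> D2 phi 1 b <= D2 phi 1 a).
{ intros a b Hab.
  destruct (MVT_cor2 (D2 phi 1) (D2 (D2 phi) 1) a b Hab) as (c & E & _).
  - intros c _. apply is_derive_Reals. apply (Ckbar_D2 0); auto.
  - specialize (Hf22 c). nra. }
assert (Hzero : forall a, exists c, D2 phi 1 c = 0 /\ a < c < a + 2 * PI).
{ intros a. pose proof PI_RGT_0.
  destruct (MVT_cor2 (phi 1) (D2 phi 1) a (a + 2 * PI)) as (c & E & Hc); [lra| |].
  - intros c _. apply is_derive_Reals. apply (Ckbar_D2 1); auto.
  - exists c. split; [|exact Hc]. rewrite (Hper 1 I1 a) in E. nra. }
intros y.
assert (Z : D2 phi 1 y = 0).
{ destruct (Hzero y) as (c & Ec & Hc). destruct (Hzero (y - 2 * PI)) as (c' & Ec' & Hc').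
  pose proof (Hmono y c ltac:(lra)). pose proof (Hmono c' y ltac:(lra)). lra. }
specialize (Hkey y). specialize (Hexit y). rewrite Z in Hkey, Hexit.
assert (0 < b1 ^ 2) by (apply pow_lt; lra).
split; [|split; [exact Z|nra]].
destruct (Hsign y) as [_ Hs]. apply Rsqr_inj; [exact Hs|lra|]. unfold Rsqr. lra.
Qed.

(** * The difference of two flows *)

Lemma degenerate_elliptic_opp (A C B1 B2 P P1 P2 P11 P22 : R -> R -> R) :
  degenerate_elliptic A C B1 B2 P P1 P2 P11 P22 ->
  degenerate_elliptic A C B1 B2 (fun x y => - P x y) (fun x y => - P1 x y)
    (fun x y => - P2 x y) (fun x y => - P11 x y) (fun x y => - P22 x y).
Proof.
intros [HA HA1 HC HB1 cA cC cB1 cB2 cP Hper D1' D2' D11' D22' Heq]. split; auto.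
- intros x y. apply continuity_2d_pt_opp; auto.
- intros x y. rewrite Hper. reflexivity.
- intros x y Hx.
  apply is_derive01_ext with (fun t => 0 - P t y); [exact Hx|intros; ring|].
  replace (- P1 x y) with (0 - P1 x y) by ring.
  apply is_derive01_minus; auto. apply is_derive01_const; exact Hx.
- intros x y Hx. apply (is_derive_opp (P x)); auto.
- intros x y Hx. apply (is_derive_opp (fun t => P1 t y)); auto.
- intros x y Hx. apply (is_derive_opp (P2 x)); auto.
- intros x y Hx. specialize (Heq x y Hx). lra.
Qed.

(** Subtracting the two equations with the principal coefficients taken at the
    symmetric flow [w] gives a linear equation for [phi - w] whose ellipticity
    is that of the symmetric flow, even where the flow of [phi] is supersonic. The
    second derivatives of [phi] appear only in the first order coefficients. *)
Lemma difference_degenerate_elliptic (gamma c0 b0 b1 : R) (n B w u U : R -> R)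
    (phi : R -> R -> R) :
  1 < gamma -> is_b1 gamma c0 b1 -> admissible_profile n ->
  symmetric_speed gamma c0 b0 b1 n (Derive01 n) u U ->
  (forall x, I01 x -> is_derive01 w x (u x)) ->
  C2_solution gamma c0 n b1 B phi ->
  exists A C B1 B2 P11 P22, degenerate_elliptic A C B1 B2
    (fun x y => phi (clamp x) y - w (clamp x)) (fun x y => D1 phi (clamp x) y - u (clamp x))
    (fun x y => D2 phi (clamp x) y) P11 P22.
Proof.
intros Hg Hb1 Hadm Hu Hw Hsol.
pose proof (exit_flow_radial gamma c0 b1 n B phi Hg Hb1 Hadm Hsol) as Hexit.
destruct Hsol as ((Hper & Hf) & Heq & _ & _ & (_ & Hsign2)).
pose proof (admissible_profile_profile n Hadm) as Hn.
set (n1 := Derive01 n) in *.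
assert (I1 : I01 1) by (unfold I01; lra).
assert (H1 : Ckbar 1 (D1 phi)) by apply Hf. assert (H2 : Ckbar 1 (D2 phi)) by apply Hf.
pose proof (proj1 Hb1) as Hb1p.
destruct (profile_continuity_2d _ _ _ Hn) as (Cn & Cn1 & Hn0). fold n1 in Cn1.
assert (Cf := C0bar_clamp _ (Ckbar_C0bar 2 phi Hf)).
assert (C1 := C0bar_clamp _ (Ckbar_C0bar 1 (D1 phi) H1)).
assert (C2 := C0bar_clamp _ (Ckbar_C0bar 1 (D2 phi) H2)).
assert (C11 := C0bar_clamp _ (Ckbar_C0bar 0 (D1 (D1 phi)) (proj1 (proj2 (proj2 H1))))).
assert (C12 := C0bar_clamp _ (Ckbar_C0bar 0 (D1 (D2 phi)) (proj1 (proj2 (proj2 H2))))).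
assert (C22 := C0bar_clamp _ (Ckbar_C0bar 0 (D2 (D2 phi)) (proj2 (proj2 (proj2 H2))))).
assert (Cw : forall x y, continuity_2d_pt (fun s _ => w (clamp s)) x y).
{ intros x y. apply continuity_2d_pt_fst. apply (continuous01_clamp w). intros t Ht.
  exact (is_derive01_continuous01 w t _ Ht (Hw t Ht)). }
assert (Cu : forall x y, continuity_2d_pt (fun s _ => u (clamp s)) x y).
{ intros x y. apply continuity_2d_pt_fst. apply (continuous01_clamp u). intros t Ht.
  exact (is_derive01_continuous01 u t _ Ht (sy_derive _ _ _ _ _ _ _ _ Hu t Ht)). }
set (c2 := fun x : R => c0 - (gamma - 1) / 2 * u (clamp x) ^ 2).
assert (Cc2 : forall x y, continuity_2d_pt (fun s _ => c2 s) x y).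
{ intros x y. unfold c2. continuity_2d. }
exists (fun x _ => n (clamp x) ^ 2 * (c2 x - u (clamp x) ^ 2)), (fun x _ => c2 x),
  (fun x y => - ((gamma + 1) / 2 * n (clamp x) ^ 2 * D1 (D1 phi) (clamp x) y
                   * (D1 phi (clamp x) y + u (clamp x)))
     - (gamma - 1) / 2 * D2 (D2 phi) (clamp x) y * (D1 phi (clamp x) y + u (clamp x))
     + n (clamp x) * n1 (clamp x)
       * (c2 x - (gamma - 1) / 2 * D1 phi (clamp x) y * (D1 phi (clamp x) y + u (clamp x)))),
  (fun x y => - ((gamma - 1) / 2 * D2 phi (clamp x) y * D1 (D1 phi) (clamp x) y)
     - 2 * D1 phi (clamp x) y * D1 (D2 phi) (clamp x) y
     - (gamma + 1) / 2 * D2 phi (clamp x) y * D2 (D2 phi) (clamp x) y / n (clamp x) ^ 2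
     + (3 - gamma) / 2 * n1 (clamp x) * D1 phi (clamp x) y * D2 phi (clamp x) y / n (clamp x)),
  (fun x y => D1 (D1 phi) (clamp x) y - U (clamp x)), (fun x y => D2 (D2 phi) (clamp x) y).
assert (Hc2 : forall x, 0 <= x < 1 -> 0 < c2 x /\ 0 < c2 x - u (clamp x) ^ 2).
{ intros x Hx. assert (Ix : I01 x) by (unfold I01; lra).
  pose proof (sy_pos _ _ _ _ _ _ _ _ Hu x Ix). pose proof (sy_subsonic _ _ _ _ _ _ _ _ Hu x Hx).
  unfold c2. rewrite clamp_id by exact Ix. split; [apply (sound2_pos gamma c0 b1); auto; lra|].
  rewrite (sound2_minus_speed2 gamma c0 b1); auto. apply Rmult_lt_0_compat; nra. }
split.
- intros x _ Hx. apply Rmult_lt_0_compat; [|apply Hc2; exact Hx].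
  apply pow_lt, (pr_pos _ _ _ Hn), clamp_I01.
- intros _. unfold c2. rewrite clamp_id by exact I1.
  rewrite (sound2_minus_speed2 gamma c0 b1), (sy_exit _ _ _ _ _ _ _ _ Hu) by auto. ring.
- intros x _ Hx. apply Hc2; exact Hx.
- intros y. rewrite clamp_id by exact I1. destruct (Hexit y) as (E1 & _ & E22).
  rewrite E1, E22, (sy_exit _ _ _ _ _ _ _ _ Hu), (pr_n_exit _ _ _ Hn).
  rewrite (pr_n1_exit _ _ _ Hn). specialize (Hsign2 y).
  assert (0 < (gamma + 1) / 2 * 1 ^ 2 * D1 (D1 phi) 1 y * (b1 + b1)).
  { repeat apply Rmult_lt_0_compat; lra. }
  lra.
- intros x y. continuity_2d.
- intros x y. continuity_2d.
- intros x y. continuity_2d.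
- intros x y. continuity_2d; try (apply pow_nonzero); apply Hn0; exact 0.
- intros x y. continuity_2d.
- intros x y. rewrite (Hper _ (clamp_I01 x) y). reflexivity.
- intros x y Hx. rewrite !(clamp_id x) by exact Hx.
  apply is_derive01_ext with (fun t => phi t y - w t); [exact Hx| |].
  + intros t Ht. rewrite clamp_id by exact Ht. reflexivity.
  + apply is_derive01_minus; [exact Hx|apply (Ckbar_D1 1); auto|apply Hw; exact Hx].
- intros x y Hx. rewrite clamp_id by (unfold I01; lra).
  replace (D2 phi x y) with (minus (D2 phi x y) 0) by (unfold minus, plus, opp; simpl; ring).
  apply @is_derive_minus; [|apply @is_derive_const].
  apply (Ckbar_D2 1); [exact Hf|unfold I01; lra].
- intros x y Hx. assert (Ix : I01 x) by (unfold I01; lra). rewrite !(clamp_id x) by exact Ix.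
  apply is_derive01_is_derive; [exact Hx|].
  apply is_derive01_ext with (fun t => D1 phi t y - u t); [exact Ix| |].
  + intros t Ht. rewrite clamp_id by exact Ht. reflexivity.
  + apply is_derive01_minus; [exact Ix|apply (Ckbar_D1 0); auto|].
    apply (sy_derive _ _ _ _ _ _ _ _ Hu); exact Ix.
- intros x y Hx. assert (Ix : I01 x) by (unfold I01; lra). rewrite clamp_id by exact Ix.
  apply (Ckbar_D2 0); auto.
- intros x y Hx. assert (Ix : I01 x) by (unfold I01; lra). unfold c2. rewrite clamp_id by exact Ix.
  pose proof (sy_ode _ _ _ _ _ _ _ _ Hu x Hx) as Ho.
  pose proof (Heq x y Hx) as He. cbv zeta in He.
  unfold sound2, speed2 in He. fold n1 in He.
  pose proof (pr_pos _ _ _ Hn x Ix) as Hnx.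
  (* the left-hand side is the equation of [phi] minus [n] times that of [u] *)
  match type of He with ?l = 0 => match type of Ho with ?m = 0 =>
    transitivity (l - n x * m); [field; lra|rewrite He, Ho; ring] end end.
Qed.

(** At an extremum of [phi - w] on the entry circle the flow of [phi] is radial,
    so that there [B] alone compares the two speeds; with the Cauchy data at the
    exit this is what the maximum principle needs. *)
Lemma rigidity (gamma c0 b0 b1 : R) (n B w u U : R -> R) (phi : R -> R -> R) :
  1 < gamma -> is_b1 gamma c0 b1 -> 0 < b0 -> admissible_profile n ->
  symmetric_speed gamma c0 b0 b1 n (Derive01 n) u U ->
  (forall x, I01 x -> is_derive01 w x (u x)) ->
  C2_solution gamma c0 n b1 B phi ->
  ((forall y, b0 ^ 2 <= B y) \/ (forall y, B y <= b0 ^ 2)) ->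
  exists k, forall x y, I01 x -> phi x y = w x + k.
Proof.
intros Hg Hb1 Hb0 Hadm Hu Hw Hsol HB.
destruct (difference_degenerate_elliptic gamma c0 b0 b1 n B w u U phi Hg Hb1 Hadm Hu Hw Hsol)
  as (A & C & B1 & B2 & P11 & P22 & HP).
pose proof (exit_flow_radial gamma c0 b1 n B phi Hg Hb1 Hadm Hsol) as Hexit.
destruct Hsol as ((_ & Hf) & _ & _ & Hentry & (Hsign & _)).
assert (I0 : I01 0) by (unfold I01; lra). assert (I1 : I01 1) by (unfold I01; lra).
assert (H2 : Ckbar 1 (D2 phi)) by apply Hf.
(* [s] is the sign with which [phi 0] is maximal at [y] *)
assert (Hrad : forall s y, (s = 1 \/ s = -1) -> (forall z, s * phi 0 z <= s * phi 0 y) ->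
  D2 phi 0 y = 0).
{ intros s y Hs Hm.
  destruct (second_derivative_test (fun z => s * phi 0 z) (fun z => s * D2 phi 0 z)
    (s * D2 (D2 phi) 0 y) y 1) as [Z _]; try lra.
  - intros z _. apply is_derive_scal. apply (Ckbar_D2 1); auto.
  - apply is_derive_scal. apply (Ckbar_D2 0); auto.
  - intros z _. apply Hm.
  - destruct Hs as [-> | ->]; lra. }
assert (Hspeed : forall y, D2 phi 0 y = 0 -> D1 phi 0 y ^ 2 = B y).
{ intros y Z. rewrite <- Hentry, Z. unfold Rdiv. ring. }
destruct HB as [HB|HB].
- destruct (max_principle_constant _ _ _ _ _ _ _ _ _ HP) as [k Hk].
  + intros y. rewrite clamp_id by exact I1. destruct (Hexit y) as [-> _].
    rewrite (sy_exit _ _ _ _ _ _ _ _ Hu). ring.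
  + intros y Hm. rewrite clamp_id by exact I0. rewrite (sy_entry _ _ _ _ _ _ _ _ Hu).
    assert (Z : D2 phi 0 y = 0).
    { apply (Hrad 1); [left; reflexivity|]. intros z. specialize (Hm 0 z I0).
      rewrite clamp_id in Hm by exact I0. lra. }
    specialize (Hspeed y Z). specialize (HB y). destruct (Hsign y) as [Hs _]. nra.
  + exists k. intros x y Hx. specialize (Hk x y Hx). rewrite clamp_id in Hk by exact Hx. lra.
- destruct (max_principle_constant _ _ _ _ _ _ _ _ _ (degenerate_elliptic_opp _ _ _ _ _ _ _ _ _ HP))
    as [k Hk].
  + intros y. rewrite clamp_id by exact I1. destruct (Hexit y) as [-> _].
    rewrite (sy_exit _ _ _ _ _ _ _ _ Hu). ring.
  + intros y Hm. rewrite clamp_id by exact I0. rewrite (sy_entry _ _ _ _ _ _ _ _ Hu).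
    assert (Z : D2 phi 0 y = 0).
    { apply (Hrad (-1)); [right; reflexivity|]. intros z. specialize (Hm 0 z I0).
      rewrite clamp_id in Hm by exact I0. lra. }
    specialize (Hspeed y Z). specialize (HB y). destruct (Hsign y) as [Hs _]. nra.
  + exists (- k). intros x y Hx. specialize (Hk x y Hx). rewrite clamp_id in Hk by exact Hx. lra.
Qed.

(** * Radial potentials *)

Lemma radial_derivatives (f : R -> R -> R) (g g' : R -> R) :
  (forall x y, I01 x -> f x y = g x) -> (forall x, I01 x -> is_derive01 g x (g' x)) ->
  (forall x y, I01 x -> D1 f x y = g' x) /\ (forall x y, I01 x -> D2 f x y = 0) /\
  (forall x y, I01 x -> ex_derive01 (fun t => f t y) x /\ ex_derive (fun t => f x t) y).
Proof.
intros E D.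
assert (K1 : forall x y, I01 x -> is_derive01 (fun t => f t y) x (g' x)).
{ intros x y Hx. apply is_derive01_ext with g; auto. intros t Ht. symmetry. apply E, Ht. }
assert (K2 : forall x y, I01 x -> is_derive (fun t => f x t) y 0).
{ intros x y Hx. apply is_derive_ext with (fun _ => g x); [|apply @is_derive_const].
  intros t. symmetry. apply E, Hx. }
split; [|split].
- intros x y Hx. apply is_derive01_unique; auto.
- intros x y Hx. apply is_derive_unique; auto.
- intros x y Hx. split; eexists; eauto.
Qed.

Lemma symmetric_flow_is_solution (gamma c0 b0 b1 k : R) (n w u U : R -> R) (phi : R -> R -> R) :
  1 < gamma -> 0 < b0 -> admissible_profile n ->
  symmetric_speed gamma c0 b0 b1 n (Derive01 n) u U ->
  (forall x, I01 x -> is_derive01 w x (u x)) ->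
  (forall x y, I01 x -> phi x y = w x + k) ->
  C2_solution gamma c0 n b1 (fun _ => b0 ^ 2) phi.
Proof.
intros Hg Hb0 Hadm Hu Hw E.
pose proof (admissible_profile_profile n Hadm) as Hn.
assert (I0 : I01 0) by (unfold I01; lra). assert (I1 : I01 1) by (unfold I01; lra).
assert (Hwk : forall x, I01 x -> is_derive01 (fun t => w t + k) x (u x)).
{ intros x Hx. apply is_derive01_ext with (fun t => w t - (- k)); [exact Hx|intros; ring|].
  rewrite <- (Rminus_0_r (u x)). apply is_derive01_minus; auto. apply is_derive01_const; exact Hx. }
assert (H0 : forall x, I01 x -> is_derive01 (fun _ => 0) x 0).
{ intros x Hx. apply is_derive01_const; exact Hx. }
destruct (radial_derivatives phi _ _ E Hwk) as (E1 & E2 & X).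
destruct (radial_derivatives (D1 phi) _ _ E1 (sy_derive _ _ _ _ _ _ _ _ Hu)) as (E11 & E21 & X1).
destruct (radial_derivatives (D2 phi) _ _ E2 H0) as (E12 & E22 & X2).
assert (C0 : forall f : R -> R -> R, (forall x y, I01 x -> f x y = 0) -> C0bar f).
{ intros f Ef. apply (C0bar_of_continuous01 f (fun _ => 0)); [|exact Ef].
  intros x Hx. exact (is_derive01_continuous01 _ x 0 Hx (H0 x Hx)). }
assert (Cu : C0bar (D1 phi)).
{ apply (C0bar_of_continuous01 _ u); [|exact E1]. intros x Hx.
  exact (is_derive01_continuous01 _ x _ Hx (sy_derive _ _ _ _ _ _ _ _ Hu x Hx)). }
split; [|split; [|split; [|split]]].
- split.
  + intros x Hx y. rewrite !E by exact Hx. reflexivity.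
  + split; [|split; [exact X|split]].
    * apply (C0bar_of_continuous01 _ _) with (2 := E). intros x Hx.
      exact (is_derive01_continuous01 _ x _ Hx (Hwk x Hx)).
    * split; [exact Cu|split; [exact X1|split]]; [|apply C0; exact E21].
      apply (C0bar_of_continuous01 _ U); [apply (sy_derive_cont _ _ _ _ _ _ _ _ Hu)|exact E11].
    * split; [apply C0; exact E2|split; [exact X2|split]]; apply C0; [exact E12|exact E22].
- intros x y Hx. assert (Ix : I01 x) by (unfold I01; lra). cbv zeta. unfold sound2, speed2.
  rewrite E1, E2, E11, E12, E22 by exact Ix.
  pose proof (sy_ode _ _ _ _ _ _ _ _ Hu x Hx) as Ho.
  pose proof (pr_pos _ _ _ Hn x Ix) as Hnx.
  match type of Ho with ?m = 0 =>
    transitivity (n x * m); [field; lra|rewrite Ho; ring] end.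
- intros y. rewrite E1, E2, (sy_exit _ _ _ _ _ _ _ _ Hu) by exact I1. ring.
- intros y. rewrite E1, E2, (sy_entry _ _ _ _ _ _ _ _ Hu) by exact I0. unfold Rdiv. ring.
- split.
  + intros y. rewrite !E1 by assumption.
    pose proof (sy_pos _ _ _ _ _ _ _ _ Hu 0 I0). pose proof (sy_pos _ _ _ _ _ _ _ _ Hu 1 I1). lra.
  + intros y. rewrite E11 by exact I1. apply (sy_accelerating _ _ _ _ _ _ _ _ Hu).
Qed.

Theorem theorem1p1 :
  forall (gamma c0 : R) (n : R -> R) (b0 b1 : R),
    1 < gamma -> 0 < c0 ->
    admissible_profile n ->
    is_b1 gamma c0 b1 ->
    is_b0 gamma c0 n b1 b0 ->
    ((exists phib : R -> R, symmetric_solution gamma c0 n b0 b1 phib) /\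
     (forall phib : R -> R, symmetric_solution gamma c0 n b0 b1 phib ->
        forall phi : R -> R -> R,
          C2_solution gamma c0 n b1 (fun _ => b0 ^ 2) phi <->
          (exists k : R, forall x y : R, I01 x -> phi x y = phib x + k))) /\
    (forall B : R -> R,
       periodic B ->
       (forall y, 0 < B y) ->
       ~ (forall y, B y = b0 ^ 2) ->
       ((forall y, b0 ^ 2 <= B y) \/ (forall y, B y <= b0 ^ 2)) ->
       ~ (exists phi : R -> R -> R, C2_solution gamma c0 n b1 B phi)).
Proof.
intros gamma c0 n b0 b1 Hg _ Hadm Hb1 Hb0.
pose proof (admissible_profile_profile n Hadm) as Hn.
pose proof (proj1 (proj1 Hb0)) as Hb0p.
assert (Hex := symmetric_solution_exists gamma c0 b0 b1 n _ _ Hg Hb1 Hn Hb0).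
split; [split|].
- exact Hex.
- intros w (u & rho & Hflow & Hw) phi.
  destruct (symmetric_speed_exists gamma c0 b0 b1 n _ _ u rho Hg Hb1 Hb0p Hn Hflow) as [U Hu].
  split.
  + intros Hsol.
    apply (rigidity gamma c0 b0 b1 n (fun _ => b0 ^ 2) w u U phi); auto.
    left. intros _. apply Rle_refl.
  + intros [k E]. apply (symmetric_flow_is_solution gamma c0 b0 b1 k n w u U); auto.
- intros B _ _ HB Hle [phi Hsol].
  destruct Hex as (w & u & rho & Hflow & Hw).
  destruct (symmetric_speed_exists gamma c0 b0 b1 n _ _ u rho Hg Hb1 Hb0p Hn Hflow) as [U Hu].
  destruct (rigidity gamma c0 b0 b1 n B w u U phi Hg Hb1 Hb0p Hadm Hu Hw Hsol Hle) as [k E].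
  (* a solution that equals [w + k] has the entry speed of [w] *)
  pose proof (symmetric_flow_is_solution gamma c0 b0 b1 k n w u U phi Hg Hb0p Hadm Hu Hw E) as Hsym.
  apply HB. intros y. destruct Hsol as (_ & _ & _ & <- & _). apply Hsym.
Qed.
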